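(* Let $w\in S_n$ be such that the symmetric matrix Schubert variety $\overline{X^{\mathrm{sym}}_w}$ is the variety of the CI ideal of a conditional independence statement $A\perp\!\!\!\perp B\mid C$ for an $n$-dimensional Gaussian random vector, as in one of the following two cases: \begin{enumerate} \item $A=[1,i]$, $B=[j,n]$, $C=\emptyset$ for some $i<j$, and $w=(j-1,\dots,j-i,\ n,\dots,j,\ j-i-1,\dots,1)$; \item $A=[1,i]$, $B=[j,n]$, $C=[i+1,j-1]$ for some $i<j-1$, and $w=(n,\dots,n-j+i+2,\ i,\dots,1,\ n-j+i+1,\dots,i+1)$. \end{enumerate} If $C=\emptyset$, then $Y^{\mathrm{sym}}_w$ has complexity $0$. Otherwise, $Y^{\mathrm{sym}}_w$ has complexity $(|C|-1)\left(n-1-\frac{|C|}{2}\right)$.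
   Context: $w$ is written in one-line notation (each block is a decreasing run of consecutive integers) and identified with the permutation matrix with $1$s at $(w(j),j)$; $r_M(a,b)$ is the rank of the submatrix of $M$ with rows $a,\dots,n$ and columns $1,\dots,b$. $D^\circ(w)=\{(i,j): w(j)<i,\ w^{-1}(i)>j\}$; $\mathrm{Ess}(w)$ is the set of north-east corners of its connected components; $\mathrm{dom}(w)$ is the connected component of $D^\circ(w)$ containing $(n,1)$ (possibly empty); $\mathrm{SW}(w)$ is the set of cells weakly south-west of an element of $\mathrm{Ess}(w)$; $L(w)=\mathrm{SW}(w)\setminus\mathrm{dom}(w)$. The symmetric matrix Schubert variety $\overline{X_w^{\mathrm{sym}}}$ is the variety of the ideal $I_w^{\mathrm{sym}}$ obtained by imposing the Fulton conditions $r_M(a,b)\le r_w(a,b)$, $(a,b)\in\mathrm{Ess}(w)$ (vanishing of minors of size $r_w(a,b)+1$), on a generic symmetric $n\times n$ matrix. One writes $\overline{X_w^{\mathrm{sym}}}=Y_w^{\mathrm{sym}}\times\mathbb C^{d^{\mathrm{sym}}}$, where $Y_w^{\mathrm{sym}}$ is the projection to the entries in $L(w)$ and its reflection in the diagonal, and the other factor is the projection to the entries not appearing in the Fulton conditions; here $d^{\mathrm{sym}}$ is the number of cells $(i,j)$ with $i\ge j$ not in $\mathrm{SW}(w)$. Let $\Delta^{\mathrm{low}}=\{(i,j): i\ge j\}$. The weight cone is $\sigma_w^{\mathrm{sym}}=\mathrm{Cone}(e_i-f_j : (i,j)\in L(w)\cap\Delta^{\mathrm{low}})$, with $e_1,\dots,e_n,f_1,\dots,f_n$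 the standard basis of $\mathbb Z^n\times\mathbb Z^n$, and the complexity of $Y_w^{\mathrm{sym}}$ is $\dim Y_w^{\mathrm{sym}}-\dim\sigma_w^{\mathrm{sym}}$. The CI ideal of $A\perp\!\!\!\perp B\mid C$ (for disjoint $A,B,C\subseteq[n]$ and symmetric covariance matrix $\Sigma$) is generated by the $(|C|+1)$-minors of $\Sigma_{A\cup C,B\cup C}$. *)

(* Defs.v *)
From HB Require Import structures.
From mathcomp Require Import all_boot all_order all_algebra all_fingroup.
From mathcomp Require Import complex.
From mathcomp Require Import boolp classical_sets reals constructive_ereal ereal.
From mathcomp Require Import (canonicals, coercions) mpoly.

Set Implicit Arguments.
Unset Strict Implicit.
Unset Printing Implicit Defensive.

Import Order.TTheory GRing.Theory Num.Theory.
Local Open Scope ring_scope.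

Section AlgebraicSets.
Variables (F : fieldType) (I : finType).

Definition point : Type := {ffun I -> F}.

(* F[x_c : c in I]; mpoly numbers its variables by ordinals, hence the
   enumeration of I. *)
Definition coord_ring : comNzRingType := mpoly.mpoly #|I| F.

Definition coord_var (c : I) : coord_ring :=
  mpoly.mpolyX F (mpoly.mnm1 (enum_rank c)).

Definition peval (p : coord_ring) (x : point) : F :=
  mpoly.meval (fun k => x (enum_val k)) p.

Definition ideal_gen (G : set coord_ring) : set coord_ring :=
  fun p => exists s : seq (coord_ring * coord_ring),
    (forall q, q \in s -> G q.2) /\ p = \sum_(q <- s) q.1 * q.2.

Definition variety (J : set coord_ring) : set point :=
  fun x => forall p, J p -> peval p x = 0.

(* Closed for the topology induced on Z by the Zariski topology of F^I. *)
Definition closed_in (Z T : set point) : Prop :=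
  exists J : set coord_ring, T = (Z `&` variety J)%classic.

Definition irreducible_in (Z T : set point) : Prop :=
  (T !=set0)%classic /\
  forall T1 T2 : set point, closed_in Z T1 -> closed_in Z T2 ->
    T = (T1 `|` T2)%classic -> T = T1 \/ T = T2.

(* A strict chain T 0 < T 1 < ... < T k of irreducible closed subsets of Z. *)
Definition irreducible_chain (Z : set point) (k : nat) (T : nat -> set point) :=
  (forall l, (l <= k)%N -> closed_in Z (T l) /\ irreducible_in Z (T l)) /\
  (forall l, (l < k)%N -> (T l `<` T l.+1)%classic).

(* Krull dimension of Z with its Zariski topology; it is -oo when Z is empty. *)
Definition krull_dim (R : realType) (Z : set point) : \bar R :=
  ereal_sup (fun d => exists k T, irreducible_chain Z k T /\ d = (k%:R)%:E).

End AlgebraicSets.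

(* The submatrix with rows in A and columns in B. *)
Definition sub_rc (K : Type) n (A B : {set 'I_n}) (M : 'M[K]_n) :
    'M[K]_(#|A|, #|B|) :=
  mxsub (@enum_val _ (mem A)) (@enum_val _ (mem B)) M.

Definition minors (K : comNzRingType) p q (k : nat) (N : 'M[K]_(p, q)) : set K :=
  fun m => exists (f : 'I_k -> 'I_p) (g : 'I_k -> 'I_q),
    [/\ {homo f : x y / (x < y)%N}, {homo g : x y / (x < y)%N}
      & m = \det (mxsub f g N)].

(* The cell in row r and column c is the pair (r, c). Rows and columns are
   numbered from 0 by 'I_n, so that the 1-based cell (n,1) is the pair (n-1, 0). *)
Definition cell n : finType := ('I_n * 'I_n)%type.

Section Diagrams.
Variables (n : nat) (w : 'S_n).

Definition oneline : seq nat := [seq (w k).+1 | k <- enum 'I_n].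

Definition opp_diagram : {set cell n} :=
  [set c : cell n | (w c.2 < c.1)%N && (c.2 < (w^-1)%g c.1)%N].

(* Connected components are taken for the relation of sharing an edge. *)
Definition adjacent : rel (cell n) := fun c d =>
  [&& c \in opp_diagram, d \in opp_diagram &
   ((c.1 == d.1) && ((c.2.+1 == d.2 :> nat) || (d.2.+1 == c.2 :> nat))) ||
   ((c.2 == d.2) && ((c.1.+1 == d.1 :> nat) || (d.1.+1 == c.1 :> nat)))].

(* Empty when c is not in the diagram. *)
Definition component (c : cell n) : {set cell n} :=
  [set d in opp_diagram | (c \in opp_diagram) && connect adjacent c d].

Definition NE_corner (K : {set cell n}) (c : cell n) : bool :=
  [&& c \in K,
      [forall d in K, ~~ ((d.2 == c.2) && (d.1.+1 == c.1 :> nat))] &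
      [forall d in K, ~~ ((d.1 == c.1) && (d.2 == c.2.+1 :> nat))]].

Definition Ess : {set cell n} := [set c : cell n | NE_corner (component c) c].

Definition dom : {set cell n} :=
  [set d : cell n | [exists c : cell n,
     [&& c.1.+1 == n, c.2 == 0%N :> nat & d \in component c]]].

Definition SW : {set cell n} :=
  [set c : cell n | [exists e in Ess, (e.1 <= c.1)%N && (c.2 <= e.2)%N]].

Definition Lset : {set cell n} := SW :\: dom.

Definition low_cells : {set cell n} := [set c : cell n | (c.2 <= c.1)%N].

(* The permutation matrix with 1s at (w(j),j): the transpose of perm_mx w. *)
Definition wmx (K : pzRingType) : 'M[K]_n := (perm_mx w)^T.

End Diagrams.

Definition rows_from n (a : 'I_n) : {set 'I_n} := [set k : 'I_n | (a <= k)%N].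
Definition cols_upto n (b : 'I_n) : {set 'I_n} := [set k : 'I_n | (k <= b)%N].

Definition rk_SW (F : fieldType) n (M : 'M[F]_n) (a b : 'I_n) : nat :=
  \rank (sub_rc (rows_from a) (cols_upto b) M).

(* Coordinates of the space of symmetric matrices: the entries on or below the
   diagonal. *)
Definition sym_coord n : finType := {c : cell n | (c.2 <= c.1)%N}.

Lemma sym_cell_proof n (i j : 'I_n) :
  let c : cell n := if (j <= i)%N then (i, j) else (j, i) in (c.2 <= c.1)%N.
Proof. by case: leqP => //= /ltnW. Qed.

Definition sym_cell n (i j : 'I_n) : sym_coord n :=
  exist _ (if (j <= i)%N then (i, j) else (j, i)) (sym_cell_proof i j).

Definition generic_sym (F : fieldType) n : 'M[coord_ring F (sym_coord n)]_n :=
  \matrix_(i, j) coord_var F (sym_cell i j).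

Section SymmetricSchubert.
Variables (F : fieldType) (n : nat) (w : 'S_n).

Definition I_sym : set (coord_ring F (sym_coord n)) :=
  ideal_gen (fun p => exists2 c : cell n, c \in Ess w &
    minors (rk_SW (wmx w F) c.1 c.2).+1
      (sub_rc (rows_from c.1) (cols_upto c.2) (generic_sym F n)) p).

Definition X_sym : set (point F (sym_coord n)) := variety I_sym.

Definition Y_coord : finType :=
  {c : sym_coord n |
    (val c \in Lset w) || (((val c).2, (val c).1) \in Lset w)}.

Definition Y_sym : set (point F Y_coord) :=
  fun y => exists2 x, X_sym x & y = [ffun c : Y_coord => x (val c)].

End SymmetricSchubert.

Arguments I_sym F {n} w _.
Arguments X_sym F {n} w _.
Arguments Y_sym F {n} w _.

Definition CI_ideal (F : fieldType) n (A B C : {set 'I_n}) :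
    set (coord_ring F (sym_coord n)) :=
  ideal_gen (minors #|C|.+1 (sub_rc (A :|: C) (B :|: C) (generic_sym F n))).

Arguments CI_ideal F {n} A B C _.

Section WeightCone.
Variables (R : realType) (n : nat) (w : 'S_n).

(* e_i - f_j, for the cell (i,j) *)
Definition weight (c : cell n) : 'rV[R]_(n + n) :=
  row_mx (delta_mx 0 c.1) (- delta_mx 0 c.2).

Definition weight_cone : set 'rV[R]_(n + n) :=
  fun v => exists a : cell n -> R, (forall c, 0 <= a c) /\
    v = \sum_(c in Lset w :&: low_cells n) a c *: weight c.

End WeightCone.

Arguments weight_cone R {n} w _.

(* The dimension of the linear span of K: the largest number of linearly
   independent vectors in K. *)
Definition span_dim (R : realType) m (K : set 'rV[R]_m) : nat :=
  \max_(k < m.+1 |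
      `[< exists A : 'M[R]_(k, m), row_free A /\ forall l, K (row l A) >]) k.

Definition complexity (R : realType) (n : nat) (w : 'S_n) : \bar R :=
  (krull_dim R (Y_sym R[i] w) - ((span_dim (weight_cone R w))%:R)%:E)%E.

(* [a, b] as a set of 1-based indices. *)
Definition index_itv n (a b : nat) : {set 'I_n} :=
  [set k : 'I_n | (a <= k.+1 <= b)%N].

(* The run b, b-1, ..., a; it is empty when b < a. *)
Definition decr (b a : nat) : seq nat := rev (index_iota a b.+1).

(* Main.v *)
Require Import Defs.
From HB Require Import structures.
From mathcomp Require Import all_boot all_order all_algebra all_fingroup.
From mathcomp Require Import complex.
From mathcomp Require Import boolp classical_sets reals constructive_ereal ereal.
From mathcomp Require Import (canonicals, coercions) mpoly.
From mathcomp Require Import zify ring.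

(* When C is empty, L(w) is empty, Y_w is a point and its weight cone is zero.
   Otherwise, with c = |C|, Y_w consists of the entries in rows of B or C and
   columns of A or C of the symmetric matrices for which this block has rank at
   most c. It is dominated by an affine space: its coordinates are the entries
   with an index in C, arranged in an n x c matrix [frame] whose rows in C form
   the identity and a symmetric c x c matrix [core], which parametrize the
   matrices frame * core * frame^T. To see that these are dense, write the block
   as a product X V; the part X_C V_C over C x C is symmetric, and (X_C, V_C)
   deforms along a polynomial curve to a pair of invertible matrices with
   symmetric product, for which X V is in the image of the parametrization. The
   dimension of Y_w is then the number of parameters, the number of cells on or
   below the diagonal that meet C.

   For a set dominated by an affine space of dimension d, a chain of k + 1
   irreducible closed subsets yields k algebraically independent polynomials
   on it, whence k <= d; the closures of the images of a flag of affine
   subspaces form a chain with k = d. *)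

Set Implicit Arguments.
Unset Strict Implicit.
Unset Printing Implicit Defensive.

Import Order.TTheory GRing.Theory Num.Theory.
Local Open Scope ring_scope.

(** * Polynomial maps *)

(** Both sides are ring morphisms in [p] with the same values on variables, and [cancel f g] makes
    them agree on constants. The instances are composition with a polynomial map ([peval_comp]) and
    restriction to a polynomial curve ([peval_curve]). *)
Lemma mmap_meval (F : comNzRingType) (S : comNzRingType) m
    (f : {rmorphism F -> S}) (g : {rmorphism S -> F}) (h : 'I_m -> S)
    (p : mpoly.mpoly m F) :
  cancel f g ->
  g (mpoly.mmap f h p) = mpoly.meval (fun k => g (h k)) p.
Proof.
move=> fK; rewrite mpoly.mevalE /mpoly.mmap rmorph_sum.
apply: eq_bigr => b _; rewrite rmorphM fK; congr (_ * _).
by rewrite /mpoly.mmap1 rmorph_prod; apply: eq_bigr => i _; rewrite rmorphXn.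
Qed.

Section PolynomialMaps.
Variables (F : fieldType) (I J : finType).

Lemma pevalM (p q : coord_ring F I) x : peval (p * q) x = peval p x * peval q x.
Proof. exact: rmorphM. Qed.

Lemma peval_var (c : I) (x : Defs.point F I) : peval (coord_var F c) x = x c.
Proof. by rewrite /peval mpoly.mevalXU enum_rankK. Qed.

Definition pmap_eval (Psi : I -> coord_ring F J) (u : Defs.point F J) : Defs.point F I :=
  [ffun c => peval (Psi c) u].

Lemma peval_comp (Psi : I -> coord_ring F J) (p : coord_ring F I) :
  exists q : coord_ring F J, forall u, peval q u = peval p (pmap_eval Psi u).
Proof.
exists (mpoly.mmap (@mpoly.mpolyC _ F) (fun k => Psi (enum_val k)) p) => u.
rewrite /peval (mmap_meval (f := @mpoly.mpolyC _ F)); last exact: mpoly.mevalC.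
by apply: mpoly.meval_eq => k; rewrite ffunE.
Qed.

Lemma peval_curve (g : I -> {poly F}) (p : coord_ring F I) :
  exists P : {poly F}, forall t, P.[t] = peval p [ffun c => (g c).[t]].
Proof.
exists (mpoly.mmap (@polyC F) (fun k => g (enum_val k)) p) => t.
rewrite -[LHS]/(horner_eval t _) (mmap_meval (f := @polyC F)); last first.
  by move=> a; rewrite /= /horner_eval hornerC.
by apply: mpoly.meval_eq => k; rewrite ffunE.
Qed.

End PolynomialMaps.

(** Characteristic zero makes the naturals below [size P] distinct roots, one more than the degree
    allows. *)
Lemma poly_eq0_horner (F : numFieldType) (P : {poly F}) :
  (forall t, P.[t] = 0) -> P = 0.
Proof.
move=> P0; apply/eqP; apply: contraT => nzP.
pose rs : seq F := [seq k%:R | k <- iota 0 (size P)].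
suff: (size rs < size P)%N by rewrite size_map size_iota ltnn.
apply: max_poly_roots => //; first by apply/allP => t _; rewrite /root P0.
by rewrite map_inj_uniq ?iota_uniq //; apply: mulrIn; rewrite oner_eq0.
Qed.

(** * Monomials and algebraic dependence *)

Fixpoint expo (K k : nat) : finType :=
  if k is k'.+1 then ('I_K * expo K k')%type else unit.

(** Exponent vectors are nested pairs so that the exponent of the last polynomial splits off in
    inductions on [k]. *)
Fixpoint monomial (S : comNzRingType) (f : nat -> S) (K k : nat) : expo K k -> S :=
  if k is k'.+1 then fun a : expo K k'.+1 => f k' ^+ a.1 * monomial f a.2
  else fun _ => 1.

Lemma card_expo K k : #|expo K k| = (K ^ k)%N.
Proof.
elim: k => [|k IH]; first by rewrite card_unit.
by rewrite card_prod card_ord IH expnS.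
Qed.

Lemma eq_monomial (S : comNzRingType) (f g : nat -> S) K k (a : expo K k) :
  f =1 g -> monomial f a = monomial g a.
Proof. by move=> fg; elim: k a => //= k IH a; rewrite fg IH. Qed.

Lemma rmorph_monomial (S S' : comNzRingType) (phi : {rmorphism S -> S'})
    (f : nat -> S) K k (a : expo K k) :
  phi (monomial f a) = monomial (phi \o f) a.
Proof.
by elim: k a => [a|k IH a] /=; rewrite ?rmorph1 // rmorphM rmorphXn IH.
Qed.

Section Dependence.
Variables (F : fieldType) (m : nat).
Implicit Types p q : mpoly.mpoly m F.

(** [msize] is the degree plus one, and 0 at the zero polynomial; with bounds of the form [_.+1],
    degrees add. *)
Lemma msize_mul_le p q a b :
  (mpoly.msize p <= a.+1 -> mpoly.msize q <= b.+1 ->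
   mpoly.msize (p * q) <= (a + b).+1)%N.
Proof.
move=> pa qb.
have [->|p0] := eqVneq p 0; first by rewrite mul0r mpoly.msize0.
have [->|q0] := eqVneq q 0; first by rewrite mulr0 mpoly.msize0.
rewrite mpoly.msizeM //; move: pa qb; move: (mpoly.msize p) (mpoly.msize q) => x y; lia.
Qed.

Lemma msize_exp_le p a e :
  (mpoly.msize p <= a.+1 -> mpoly.msize (p ^+ e) <= (e * a).+1)%N.
Proof.
move=> pa; elim: e => [|e IH]; first by rewrite expr0 mpoly.msize1.
by rewrite exprS mulSn msize_mul_le.
Qed.

Lemma msize_monomial_le (q : nat -> mpoly.mpoly m F) K k D (a : expo K k) :
  (forall l, (l < k)%N -> (mpoly.msize (q l) <= D.+1)%N) ->
  (mpoly.msize (monomial q a) <= (k * (K * D)).+1)%N.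
Proof.
elim: k a => [a|k IH a] qD /=; first by rewrite mpoly.msize1.
rewrite mulSn; apply: msize_mul_le; last first.
  by apply: IH => l lk; apply: qD; apply: ltnW.
apply: leq_trans (msize_exp_le _ (qD k (ltnSn k))) _.
by rewrite ltnS leq_mul2r ltnW ?orbT.
Qed.

Lemma card_bmultinom_le B : (#|{: mpoly.bmultinom m B}| <= B ^ m)%N.
Proof.
have lt_coord (b : mpoly.bmultinom m B) (i : 'I_m) :
    (mpoly.bmnm b i < B)%N.
  apply: leq_ltn_trans (mpoly.bmdeg b).
  by rewrite mpoly.mdegE (bigD1 i) //= leq_addr.
pose h (b : mpoly.bmultinom m B) := [ffun i => Ordinal (lt_coord b i)].
have h_inj : injective h.
  move=> b b' /ffunP e; apply/val_inj/mpoly.mnmP => i.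
  by have := e i; rewrite !ffunE => /(congr1 val).
by have := leq_card h h_inj; rewrite card_ffun !card_ord.
Qed.

(* Counting: the [K ^ k] monomials of exponents less than [K] in [k] polynomials
   lie in a space of dimension [O(K ^ m)]. *)
Lemma algebraic_dependence (q : nat -> mpoly.mpoly m F) k : (m < k)%N ->
  exists K (u : expo K k -> F),
    (exists a, u a != 0) /\ \sum_a u a *: monomial q a = 0.
Proof.
move=> ltmk; pose D := (\sum_(l < k) mpoly.msize (q l))%N.
have qD l : (l < k)%N -> (mpoly.msize (q l) <= D.+1)%N.
  move=> lk; apply: leqW.
  by rewrite /D (bigD1 (Ordinal lk)) //= leq_addr.
(* The monomials have degree below [B <= K * (k * D).+1], so they span at most
   [K ^ m * (k * D).+1 ^ m] dimensions. This is less than [K ^ m.+1 <= K ^ k] because [K] exceeds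
   [(k * D).+1 ^ m]. *)
pose K := ((k * D).+1 ^ m).+1; pose B := (k * (K * D)).+1.
pose c : 'M[F]_(#|expo K k|, #|{: mpoly.bmultinom m B}|) :=
  \matrix_(r, s) mpoly.mcoeff (mpoly.bmnm (enum_val s)) (monomial q (enum_val r)).
have lt_dim : (#|{: mpoly.bmultinom m B}| < #|expo K k|)%N.
  apply: leq_ltn_trans (card_bmultinom_le B) _; rewrite card_expo.
  apply: (@leq_ltn_trans ((K * (k * D).+1) ^ m)); last first.
    rewrite expnMn; apply: (@leq_trans (K ^ m.+1)); last by rewrite leq_exp2l // ltnS expn_gt0.
    by rewrite expnS mulnC ltn_pmul2r ?expn_gt0.
  have BK : (B <= K * (k * D).+1)%N by rewrite /B mulnS mulnCA -add1n leq_add2r.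
  by elim: (m) => // m' IH; rewrite !expnS leq_mul.
(* The coefficient matrix has more rows than columns; a nonzero vector of its left kernel is the
   relation. *)
have : kermx c != 0.
  rewrite -mxrank_eq0 mxrank_ker subn_eq0 -ltnNge.
  exact: leq_ltn_trans (rank_leq_col c) lt_dim.
case/rowV0Pn => v /sub_kermxP vc v0.
exists K, (fun a => v 0 (enum_rank a)); split.
  move: v0; case/rV0Pn => r vr; exists (enum_val r).
  by rewrite enum_valK.
rewrite (reindex (fun r : 'I_#|expo K k| => enum_val r)) /=; last first.
  exact/onW_bij/enum_val_bij.
transitivity (\sum_(s : mpoly.bmultinom m B)
   (\sum_(r < #|expo K k|) v 0 r * c r (enum_rank s)) *:
      mpoly.mpolyX F (mpoly.bmnm s)); last first.
  apply: big1 => s _; have /matrixP/(_ 0 (enum_rank s)) := vc.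
  by rewrite !mxE => ->; rewrite scale0r.
under [RHS]eq_bigr => s _ do rewrite scaler_suml.
rewrite exchange_big; apply: eq_bigr => r _ /=; rewrite enum_valK.
rewrite {1}(mpoly.mpolywE (msize_monomial_le (enum_val r) qD)) scaler_sumr.
by apply: eq_bigr => s _; rewrite mxE enum_rankK scalerA.
Qed.

End Dependence.

(** * Dimension of a set dominated by an affine space *)

Section ChainLength.
Variables (F : fieldType) (I : finType).
Implicit Types (Z T : set (Defs.point F I)) (p q : coord_ring F I).

Lemma closed_in_zeros Z T p :
  closed_in Z T -> closed_in Z (T `&` [set x | peval p x = 0])%classic.
Proof.
case=> J ->; exists (J `|` [set p])%classic.
apply/seteqP; split => x /=; first by case=> -[Zx Jx] px; split=> // q [/Jx|->].
by case=> Zx Jx; do !split=> //; [move=> q Jq; apply: Jx; left | apply: Jx; right].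
Qed.

Lemma closed_in_separated Z T x : closed_in Z T -> Z x -> ~ T x ->
  exists2 p, (forall y, T y -> peval p y = 0) & peval p x != 0.
Proof.
case=> J -> Zx nJx; apply: contrapT => np; apply: nJx; split=> // p Jp.
apply/eqP/negP => /negP px; apply: np; exists p => // y [_]; exact.
Qed.

Lemma irreducible_in_prod Z T p q : closed_in Z T -> irreducible_in Z T ->
  (forall x, T x -> peval p x = 0 \/ peval q x = 0) ->
  (forall x, T x -> peval p x = 0) \/ (forall x, T x -> peval q x = 0).
Proof.
move=> clT [_ irr] pq.
have [] := irr _ _ (closed_in_zeros p clT) (closed_in_zeros q clT).
- apply/seteqP; split=> x; first by move=> Tx; case: (pq x Tx); [left|right].
  by case=> -[].
- by move=> e; left=> x; rewrite e => -[].
- by move=> e; right=> x; rewrite e => -[].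
Qed.

(* [f l] vanishes on [T l] but not on [T l.+1], so in a minimal relation between
   [f 0, ..., f l] on [T l.+1] one may cancel powers of [f l] and restrict to
   [T l]. *)
Lemma chain_independent Z k (T : nat -> set (Defs.point F I)) :
  irreducible_chain Z k T ->
  exists f : nat -> coord_ring F I, forall K (u : expo K k -> F),
    (forall x, T k x -> \sum_a u a * monomial (fun l => peval (f l) x) a = 0) ->
    forall a, u a = 0.
Proof.
case=> irrT ltT.
have /choice [f fP] : forall l, exists p, (l < k)%N ->
    (forall y, T l y -> peval p y = 0) /\
    ~ (forall x, T l.+1 x -> peval p x = 0).
  move=> l; have [lk|] := boolP (l < k)%N; last by exists 0.
  have [_ /existsNP [x /not_implyP [Tx nTx]]] := ltT l lk.
  have [clT _] := irrT l (ltnW lk).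
  have Zx : Z x by have [[J TE] _] := irrT l.+1 lk; move: Tx; rewrite TE => -[].
  have [p p0 px] := closed_in_separated clT Zx nTx.
  by exists p => _; split=> // /(_ x Tx) /eqP; rewrite (negPf px).
exists f => K.
suff indep l : (l <= k)%N -> forall u : expo K l -> F,
    (forall x, T l x -> \sum_a u a * monomial (fun l => peval (f l) x) a = 0) ->
    forall a, u a = 0 by move=> u; exact: indep.
elim: l => [|l IH] lk u u0.
  (* With no polynomials the relation is a single constant, which vanishes because [T 0] has a
     point. *)
  have [_ [[x Tx] _]] := irrT 0%N isT.
  move=> []; have := u0 x Tx.
  by rewrite (eq_bigl (pred1 tt)) ?big_pred1_eq ?mulr1 // => -[].
have [f0 fn0] := fP l lk.
(* The term of index [a] in the relation after division by the [e]-th power of [f l]; it is summed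
   only over [e <= a.1], where the truncated subtraction is exact. *)
pose g x e (a : expo K l.+1) :=
  u a * (peval (f l) x ^+ (a.1 - e) * monomial (fun l => peval (f l) x) a.2).
have polyg e : exists G, forall x, peval G x = \sum_(a : expo K l.+1 | (e <= a.1)%N) g x e a.
  exists (\sum_(a : expo K l.+1 | (e <= a.1)%N)
    (mpoly.mpolyC _ (u a) * ((f l) ^+ (a.1 - e) * monomial f a.2))) => x.
  rewrite /peval rmorph_sum; apply: eq_bigr => a _.
  by rewrite !rmorphM rmorphXn /= mpoly.mevalC (rmorph_monomial (mpoly.meval _)).
have lk1 : (l <= k)%N := ltnW lk.
have sub x : T l x -> T l.+1 x by case: (ltT l lk) => sub _; apply: sub.
(* On [T l] the polynomial [f l] vanishes, so only the terms of exponent exactly [e] survive. They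
   form a relation between the earlier polynomials, to which the induction hypothesis applies. *)
have slice e (eK : (e < K)%N) :
    (forall x, T l.+1 x -> \sum_(a : expo K l.+1 | (e <= a.1)%N) g x e a = 0) ->
    forall b, u (Ordinal eK, b) = 0.
  move=> ge0; apply: IH => // x Tx; rewrite -[RHS](ge0 x (sub x Tx)).
  transitivity (\sum_(i < K | (e <= i)%N) \sum_(b : expo K l) g x e (i, b)); last first.
    by rewrite pair_big; apply: eq_big => [[i b]|[i b] _] //=; rewrite andbT.
  rewrite (bigD1 (Ordinal eK)) //= [X in _ + X]big1 ?addr0 => [|i /andP[ei iNe]].
    by apply: eq_bigr => b _; rewrite /g /= subnn mul1r.
  apply: big1 => b _; rewrite /g /= f0 // expr0n subn_eq0.
  rewrite leqNgt ltn_neqAle ei andbT eq_sym iNe /=.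
  by rewrite mul0r mulr0.
(* Once [slice] has removed the terms of exponent [e], the rest is divisible by [f l], which can be
   cancelled since [T l.+1] is irreducible and [f l] is not identically zero on it. *)
have vanish e : (forall x, T l.+1 x -> \sum_(a : expo K l.+1 | (e <= a.1)%N) g x e a = 0).
  elim: e => [|e IHe] x Tx.
    rewrite -[RHS](u0 x Tx); apply: eq_bigr => a _.
    by rewrite /g /= subn0.
  have [G GE] := polyg e.+1; have [clT irr] := irrT l.+1 lk.
  suff fG y : T l.+1 y -> peval (f l) y = 0 \/ peval G y = 0.
    by rewrite -GE; case: (irreducible_in_prod clT irr fG) => [//|]; exact.
  move=> Ty; suff : peval (f l) y * peval G y = 0.
    by move/eqP; rewrite mulf_eq0 => /orP[] /eqP ->; [left|right].
  rewrite GE -[RHS](IHe y Ty) mulr_sumr big_mkcond [RHS]big_mkcond /=.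
  apply: eq_bigr => -[i b] _ /=; rewrite /g /=; case: (ssrnat.ltngtP e i) => [ei|//|ie].
    by rewrite mulrCA; congr (_ * _); rewrite mulrA -exprS subnSK.
  rewrite (_ : i = Ordinal (leq_trans (eq_leq (congr1 succn ie)) (ltn_ord i))); last exact: val_inj.
  by rewrite slice ?mul0r.
move=> [[e eK] b]; exact: slice (vanish e) b.
Qed.
End ChainLength.

Section DominatedDimension.
Variables (F : numFieldType) (I J : finType) (Psi : I -> coord_ring F J).
Variable Z : set (Defs.point F I).
Local Notation psi := (pmap_eval Psi).

Hypothesis psiZ : forall u, Z (psi u).
Hypothesis psi_dense : forall p, (forall u, peval p (psi u) = 0) ->
  forall z, Z z -> peval p z = 0.

(** Independent polynomials on [T k] pull back to polynomials in [#|J|] variables. If [k] exceeded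
    [#|J|] these would satisfy a relation, which density carries from the image of [psi] to [Z],
    hence to [T k]. *)
Lemma irreducible_chain_le k T : irreducible_chain Z k T -> (k <= #|J|)%N.
Proof.
move=> chT; rewrite leqNgt; apply/negP => ltJk.
have [f indep] := chain_independent chT.
have /choice [q qE] := fun l => peval_comp Psi (f l).
have [K [c [[a ca] c0]]] := algebraic_dependence q ltJk.
move: ca; rewrite (indep K c) ?eqxx // => x Tx.
have Zx : Z x by have [[JT TE] _] := chT.1 k (leqnn k); move: Tx; rewrite TE => -[].
pose G : coord_ring F I := \sum_a mpoly.mpolyC _ (c a) * monomial f a.
have GE y : peval G y = \sum_a c a * monomial (fun l => peval (f l) y) a.
  rewrite /peval rmorph_sum; apply: eq_bigr => b _.
  by rewrite rmorphM /= mpoly.mevalC (rmorph_monomial (mpoly.meval _)).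
rewrite -GE; apply: psi_dense => // u; rewrite GE.
transitivity (mpoly.meval (fun k => u (enum_val k)) (\sum_a c a *: monomial q a)).
  rewrite rmorph_sum; apply: eq_bigr => b _ /=.
  rewrite mpoly.mevalZ (rmorph_monomial (mpoly.meval _)); congr (_ * _).
  by apply: eq_monomial => l; rewrite -qE.
by rewrite c0 rmorph0.
Qed.

Variables (kappa : J -> I) (u0 : Defs.point F J) (s : seq J).
Hypothesis s_enum : perm_eq s (enum J).
(** A triangular form of injectivity: the coordinate [x] can be read off the image only after the
    coordinates following it in [s] are frozen at the base point [u0]. *)
Hypothesis psi_flag : forall s1 x s2, s = s1 ++ x :: s2 ->
  forall u : Defs.point F J, (forall y, y \in s2 -> u y = u0 y) -> psi u (kappa x) = u x.

(** The affine subspace through [u0] in which the first [l] coordinates of [s] are free.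
    [flag_closure l] is the Zariski closure in [Z] of its image. *)
Definition flag l : set (Defs.point F J) :=
  fun u => forall y, y \in drop l s -> u y = u0 y.

Definition flag_closure l : set (Defs.point F I) :=
  fun z => Z z /\
    forall p, (forall u, flag l u -> peval p (psi u) = 0) -> peval p z = 0.

Lemma flag_closureP l u : flag l u -> flag_closure l (psi u).
Proof. by move=> lu; split=> // p; exact. Qed.

Lemma flag_closure_closed l : closed_in Z (flag_closure l).
Proof. by exists (fun p => forall u, flag l u -> peval p (psi u) = 0). Qed.

Lemma flag_line l u v t : flag l u -> flag l v ->
  flag l [ffun y => u y + t * (v y - u y)].
Proof.
move=> lu lv y ys; rewrite ffunE (lu y ys) (lv y ys).
by rewrite subrr mulr0 addr0.
Qed.

Lemma peval_line (p : coord_ring F I) (u v : Defs.point F J) :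
  exists P : {poly F}, forall t,
    P.[t] = peval p (psi [ffun y => u y + t * (v y - u y)]).
Proof.
have [q qE] := peval_comp Psi p.
have [P PE] := peval_curve (fun y => (u y)%:P + 'X * (v y - u y)%:P) q.
exists P => t; rewrite PE -qE; congr (peval q _).
by apply/ffunP => y; rewrite !ffunE !hornerE.
Qed.

(* Two polynomials that are nonzero somewhere on the affine space [flag l] are
   simultaneously nonzero at some point of a line in it. *)
Lemma flag_closure_irreducible l : irreducible_in Z (flag_closure l).
Proof.
split; first by exists (psi u0); apply: flag_closureP.
move=> T1 T2 cl1 cl2 TE.
have sub1 : (T1 `<=` flag_closure l)%classic by rewrite TE; left.
have sub2 : (T2 `<=` flag_closure l)%classic by rewrite TE; right.
(* A closed set that does not contain the closure of the image already misses a point of the image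
   itself. *)
have separated T' : closed_in Z T' -> ~ (flag_closure l `<=` T')%classic ->
    exists p u, [/\ flag l u, peval p (psi u) != 0
      & forall y, T' y -> peval p y = 0].
  move=> clT' /existsNP [z /not_implyP [zT nz]].
  have [p p0 pz] := closed_in_separated clT' zT.1 nz.
  apply: contrapT => nex; case/eqP: pz; apply: zT.2 => u lu.
  by apply/eqP/negP => /negP pu; apply: nex; exists p, u.
have [le1|n1] := pselect (flag_closure l `<=` T1)%classic.
  by left; apply/seteqP.
have [le2|n2] := pselect (flag_closure l `<=` T2)%classic.
  by right; apply/seteqP.
have [p [u [lu pu p0]]] := separated _ cl1 n1.
have [q [v [lv qv q0]]] := separated _ cl2 n2.
have [P PE] := peval_line p u v; have [Q QE] := peval_line q u v.
have at0 : [ffun y => u y + 0 * (v y - u y)] = u.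
  by apply/ffunP => y; rewrite ffunE mul0r addr0.
have at1 : [ffun y => u y + 1 * (v y - u y)] = v.
  by apply/ffunP => y; rewrite ffunE mul1r addrC subrK.
(* Each point of the line maps into [T1] or [T2], so one of the two polynomials vanishes there. *)
have /eqP : P * Q = 0.
  apply: poly_eq0_horner => t; rewrite hornerM.
  have := flag_closureP (flag_line t lu lv); rewrite TE.
  by case=> [/p0|/q0]; rewrite -?PE -?QE => ->; rewrite ?mul0r ?mulr0.
rewrite mulf_eq0 => /orP[] /eqP P0.
  by case/eqP: pu; rewrite -at0 -PE P0 horner0.
by case/eqP: qv; rewrite -at1 -QE P0 horner0.
Qed.

Lemma size_flag_seq : size s = #|J|.
Proof. by rewrite (perm_size s_enum) cardE. Qed.

Lemma flag_closure_chain : irreducible_chain Z #|J| flag_closure.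
Proof.
split=> l lJ.
  by split; [exact: flag_closure_closed | exact: flag_closure_irreducible].
have : s = take l s ++ drop l s by rewrite cat_take_drop.
case dE: (drop l s) => [|x s2] sE.
  by move: lJ; rewrite -size_flag_seq ltnNge -subn_eq0 -size_drop dE.
have dSE : drop l.+1 s = s2 by rewrite -add1n -drop_drop dE /= drop0.
have flagS u : flag l u -> flag l.+1 u.
  by move=> lu y; rewrite dSE => ys; apply: lu; rewrite dE inE ys orbT.
split=> [z [Zz pz]|].
  by split=> // p p0; apply: pz => u /flagS; apply: p0.
have xs2 : x \notin s2.
  have : uniq s by rewrite (perm_uniq s_enum) enum_uniq.
  by rewrite sE cat_uniq => /and3P[_ _ /=] /andP[].
(* Only the newly freed coordinate [x] leaves its frozen value. The polynomial reading [kappa x]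
   minus [u0 x] vanishes on the image of [flag l] and equals 1 at [psi u], so the inclusion is
   strict. *)
pose u : Defs.point F J := [ffun y => if y == x then u0 x + 1 else u0 y].
have us2 y : y \in s2 -> u y = u0 y.
  by move=> ys; rewrite ffunE; case: eqP ys xs2 => // -> ->.
have : flag_closure l.+1 (psi u) by apply: flag_closureP => y; rewrite dSE; apply: us2.
move=> /[swap] /[apply] -[_].
move=> /(_ (coord_var F (kappa x) - mpoly.mpolyC _ (u0 x))).
have pE z : peval (coord_var F (kappa x) - mpoly.mpolyC _ (u0 x)) z =
    z (kappa x) - u0 x.
  by rewrite {1}/peval rmorphB /= mpoly.mevalC -[mpoly.meval _ _]/(peval _ _) peval_var.
rewrite !pE (psi_flag sE us2) ffunE eqxx addrAC subrr add0r => one0.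
suff: (1 : F) = 0 by move/eqP; rewrite oner_eq0.
apply: one0 => v lv; rewrite pE.
rewrite (psi_flag sE) => [|y ys]; last by apply: lv; rewrite dE inE ys orbT.
by rewrite lv ?subrr // dE mem_head.
Qed.

Lemma krull_dim_dominated (R : realType) : krull_dim R Z = (#|J|%:R)%:E.
Proof.
apply/le_anti/andP; split.
  apply: ge_ereal_sup => _ [k [T [chT ->]]].
  by rewrite lee_fin ler_nat; apply: irreducible_chain_le chT.
apply: ereal_sup_ubound; exists #|J|, flag_closure; split=> //.
exact: flag_closure_chain.
Qed.

End DominatedDimension.

(** * Symmetric products of two matrices *)

Section SymmetricProductCurve.
Variable F : fieldType.

Local Notation constmx := (map_mx (@polyC F)).

(** Factoring out [A] leaves a characteristic matrix, whose determinant is monic. *)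
Lemma det_pencil_neq0 m (A B : 'M[F]_m) :
  A \in unitmx -> \det ('X *: constmx A + constmx B) != 0.
Proof.
move=> uA; have -> : 'X *: constmx A + constmx B =
    constmx A *m char_poly_mx (- (invmx A *m B)).
  rewrite /char_poly_mx mulmxBr mul_mx_scalar; congr (_ + _).
  by rewrite -map_mxM mulmxN map_mxN opprK mulmxA mulmxV ?mul1mx.
rewrite det_mulmx det_map_mx mulf_neq0 //.
  by rewrite polyC_eq0 -unitfE -unitmxE.
exact/monic_neq0/char_poly_monic.
Qed.

(** If [A = P *m pid_mx r *m Q] with [P], [Q] invertible, then [G = Q^T *m invmx P] gives
    [G *m A = Q^T *m pid_mx r *m Q]. *)
Lemma symmetrizer m (A : 'M[F]_m) :
  exists2 G, G \in unitmx & (G *m A)^T = G *m A.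
Proof.
exists ((row_ebase A)^T *m invmx (col_ebase A)).
  by rewrite unitmx_mul unitmx_tr unitmx_inv row_ebase_unit col_ebase_unit.
have -> : (row_ebase A)^T *m invmx (col_ebase A) *m A =
    (row_ebase A)^T *m pid_mx (\rank A) *m row_ebase A.
  by rewrite -{3}(mulmx_ebase A) -!mulmxA mulKmx ?col_ebase_unit.
by rewrite !trmx_mul trmxK tr_pid_mx mulmxA.
Qed.

(** A polynomial deformation of the pair [(X, V)] that keeps the product symmetric. The determinants
    are nonzero as polynomials, so both factors are invertible outside finitely many parameters. *)
Definition regular_sym_curve m (X V : 'M[F]_m) : Prop :=
  exists Xt Vt : 'M[{poly F}]_m,
    [/\ map_mx (horner_eval 0) Xt = X, map_mx (horner_eval 0) Vt = V,
        (Xt *m Vt)^T = Xt *m Vt, \det Xt != 0 & \det Vt != 0].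

Lemma horner0_constmx m p (A : 'M[F]_(m, p)) :
  map_mx (horner_eval 0) (constmx A) = A.
Proof. by apply/matrixP => i j; rewrite !mxE /horner_eval hornerC. Qed.

Lemma horner0_scaleX m p (A : 'M[{poly F}]_(m, p)) :
  map_mx (horner_eval 0) ('X *: A) = 0.
Proof. by apply/matrixP => i j; rewrite !mxE /horner_eval !hornerE. Qed.

(** Symmetry of the product forces [V12 = 0] and [V11] symmetric, while [V21] and [V22] are free.
    With [G] symmetrizing [V22], the product along the curve has diagonal blocks [V11 + t] and
    [t G V22 + t^2], and off-diagonal blocks [t G V21] and its transpose. *)
Lemma pid_curve p s (V : 'M[F]_(p + s)) :
  (pid_mx p *m V)^T = (pid_mx p : 'M_(p + s)) *m V ->
  regular_sym_curve (pid_mx p) V.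
Proof.
rewrite -[V]submxK pid_mx_block mulmx_block !mul1mx !mul0mx !addr0.
move: (ulsubmx V) (ursubmx V) (dlsubmx V) (drsubmx V) => V11 V12 V21 V22.
rewrite tr_block_mx => /eq_block_mx [V11s /esym]; rewrite trmx0 => -> _ _.
have [G uG Gs] := symmetrizer V22.
exists (block_mx 1%:M 0 0 ('X *: constmx G)).
exists (block_mx (constmx V11 + 'X%:M) ('X *: constmx (G *m V21)^T)
                 (constmx V21) (constmx V22 + 'X *: constmx (invmx G))).
split.
- by rewrite map_block_mx map_mx1 !map_mx0 horner0_scaleX.
- rewrite map_block_mx !map_mxD !horner0_constmx !horner0_scaleX addr0.
  by rewrite -(scalemx1 _ 'X) horner0_scaleX addr0.
- rewrite mulmx_block !mul1mx !mul0mx !addr0 !add0r tr_block_mx.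
  rewrite !mulmxDr -!scalemxAl -!scalemxAr -!map_mxM mulmxV // map_mx1.
  rewrite !linearD !linearZ /= tr_scalar_mx !map_trmx V11s trmxK Gs trmx1.
  by [].
- rewrite det_lblock det1 mul1r detZ det_map_mx mulf_neq0 ?expf_neq0 ?polyX_eq0 //.
  by rewrite polyC_eq0 -unitfE -unitmxE.
(* The second factor is a linear pencil in the parameter, with invertible leading coefficient
   [A]. *)
- pose A := block_mx 1%:M (G *m V21)^T 0 (invmx G).
  have uA : A \in unitmx.
    by rewrite unitmxE det_ublock det1 mul1r -unitmxE unitmx_inv.
  have := det_pencil_neq0 (block_mx V11 0 V21 V22) uA.
  rewrite !map_block_mx scale_block_mx add_block_mx map_mx1 !map_mx0.
  by rewrite scalemx1 scaler0 !addr0 !add0r addrC [X in block_mx _ _ _ X]addrC.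
Qed.

(* Write [X = L *m pid_mx r *m U]; the congruence by [L] preserves symmetry and
   reduces to [X = pid_mx r], where [V] is block lower triangular with symmetric
   upper left block. *)
Lemma sym_product_curve m (X V : 'M[F]_m) :
  (X *m V)^T = X *m V -> regular_sym_curve X V.
Proof.
move=> XVs; set L := col_ebase X; set U := row_ebase X.
have uL : L \in unitmx := col_ebase_unit X.
have uU : U \in unitmx := row_ebase_unit X.
pose V' := U *m V *m (invmx L)^T.
have XE : pid_mx (\rank X) *m V' = invmx L *m (X *m V) *m (invmx L)^T.
  rewrite -[X in invmx L *m (X *m V)](mulmx_ebase X) -/L -/U /V'.
  by rewrite -!mulmxA mulKmx.
have : (pid_mx (\rank X) *m V')^T = (pid_mx (\rank X) : 'M_m) *m V'.
  by rewrite XE !trmx_mul trmxK -trmx_mul XVs mulmxA.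
have pid_curve' r (W : 'M[F]_m) : (r <= m)%N ->
    (pid_mx r *m W)^T = (pid_mx r : 'M_m) *m W -> regular_sym_curve (pid_mx r) W.
  by move=> rm; move: W; rewrite -(subnKC rm) => W; apply: pid_curve.
case/(pid_curve' _ _ (rank_leq_row X)) => Xt [Vt [X0 V0 Ss dX dV]].
exists (constmx L *m Xt *m constmx U), (constmx (invmx U) *m Vt *m constmx L^T).
have unit_det W : W \in unitmx -> \det (constmx W) != 0.
  by move=> uW; rewrite det_map_mx polyC_eq0 -unitfE -unitmxE.
split.
- by rewrite !map_mxM !horner0_constmx X0 mulmx_ebase.
- rewrite !map_mxM !horner0_constmx V0 /V' !mulmxA mulVmx // mul1mx -mulmxA.
  by rewrite -trmx_mul mulmxV // trmx1 mulmx1.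
- have -> : constmx L *m Xt *m constmx U *m (constmx (invmx U) *m Vt *m constmx L^T)
      = constmx L *m (Xt *m Vt) *m constmx L^T.
    by rewrite -!mulmxA (mulmxA (constmx U)) -map_mxM mulmxV // map_mx1 mul1mx.
  by rewrite !trmx_mul !map_trmx trmxK -trmx_mul Ss !mulmxA.
- by rewrite !det_mulmx !mulf_neq0 ?unit_det.
- by rewrite !det_mulmx !mulf_neq0 ?unit_det ?unitmx_inv ?unitmx_tr.
Qed.

End SymmetricProductCurve.

(** * Ranks and minors *)

Section RankMinors.
Variable F : fieldType.

Lemma mxrank_mxsub p q k l (f : 'I_k -> 'I_p) (g : 'I_l -> 'I_q) (N : 'M[F]_(p, q)) :
  (\rank (mxsub f g N) <= \rank N)%N.
Proof.
have -> : mxsub f g N = rowsub f (colsub g N).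
  by apply/matrixP => x y; rewrite !mxE.
rewrite rowsubE; apply: leq_trans (mxrankM_maxr _ _) _.
by rewrite -mxrank_tr trmx_mxsub rowsubE -[leqRHS]mxrank_tr mxrankM_maxr.
Qed.

Lemma row_free_rowsub p q k (h : 'I_k -> 'I_p) (N : 'M[F]_(p, q)) :
  injective h -> row_free N -> row_free (rowsub h N).
Proof.
move=> h_inj /mxrankMfree Nfree; rewrite /row_free rowsubE Nfree.
suff: row_free (rowsub h (1%:M : 'M[F]_p)) by [].
apply/row_freeP; exists (rowsub h 1%:M)^T; rewrite trmx_mxsub trmx1.
apply/matrixP => a b; rewrite !mxE (bigD1 (h a)) //= !mxE eqxx mul1r.
rewrite big1 ?addr0 ?(inj_eq h_inj) // => x xa; rewrite !mxE eq_sym (negPf xa).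
by rewrite mul0r.
Qed.

(** Minors are defined with increasing index maps, whereas the rank theory selects rows and columns
    in arbitrary order. *)
Lemma increasing_rearrangement p k (f : 'I_k -> 'I_p) : injective f ->
  exists s : 'S_k, {homo (f \o s) : x y / (x < y)%N}.
Proof.
move=> f_inj; pose le (x y : 'I_p) := (x <= y)%N.
pose t := [tuple f x | x < k].
have /tuple_permP [s tE] : perm_eq (sort le t) t by rewrite perm_sort.
exists s => x y xy.
have fE z : (f (s z) : nat) = nth 0%N [seq val a | a <- sort le t] z.
  rewrite tE (nth_map (f z)) ?size_tuple // (nth_map z) ?size_tuple //.
  by rewrite -tnth_nth tnth_ord_tuple tnth_mktuple.
have sorted_t : sorted ltn [seq val a | a <- sort le t].
  rewrite ltn_sorted_uniq_leq map_inj_uniq; last exact: val_inj.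
  rewrite sort_uniq (map_inj_uniq f_inj) enum_uniq sorted_map.
  by apply: sort_sorted => a b; apply: leq_total.
rewrite /= !fE (sorted_ltn_nth ltn_trans) // inE size_map size_sort size_tuple //.
Qed.

Lemma det_row_perm_eq0 k (s : 'S_k) (A : 'M[F]_k) :
  (\det (row_perm s A) == 0) = (\det A == 0).
Proof. by rewrite row_permE det_mulmx det_perm mulf_eq0 signr_eq0. Qed.

(** If the rank were at least [k], one could pick [k] independent rows and then [k] independent
    columns of these; sorting both changes the nonzero determinant at most by a sign. *)
Lemma rank_lt_minors p q k (N : 'M[F]_(p, q)) :
  (forall m, minors k N m -> m = 0) <-> (\rank N < k)%N.
Proof.
split=> [N0|ltNk m [f [g [_ _ ->]]]]; last first.
  apply/eqP/negPn; rewrite -unitfE -unitmxE; apply/negP => /mxrank_unit rk.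
  by have := mxrank_mxsub f g N; rewrite rk leqNgt ltNk.
rewrite ltnNge; apply/negP => leKN.
pose f x := maxrankfun N (widen_ord leKN x).
have f_inj : injective f.
  by move=> x y /maxrankfun_inj /(congr1 val) /= /val_inj.
have freeN : row_free (rowsub f N).
  have -> : rowsub f N = rowsub (widen_ord leKN) (rowsub (maxrankfun N) N).
    by apply/matrixP => x y; rewrite !mxE.
  apply: row_free_rowsub (maxrowsub_free N).
  by move=> x y /(congr1 val) /= /val_inj.
have fullN : row_full (rowsub f N)^T by rewrite /row_full mxrank_tr.
pose g := fullrankfun fullN.
have g_inj : injective g by apply: fullrankfun_inj.
have : rowsub g (rowsub f N)^T \in unitmx by apply: fullrowsub_unit.
rewrite unitmxE unitfE => /eqP.
have [s s_inc] := increasing_rearrangement f_inj.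
have [t t_inc] := increasing_rearrangement g_inj.
have minor0 : \det (mxsub (f \o s) (g \o t) N) = 0.
  by apply: N0; exists (f \o s), (g \o t).
apply; apply/eqP; rewrite -(det_row_perm_eq0 t) -det_tr -(det_row_perm_eq0 s) -minor0.
by apply/eqP; congr (\det _); apply/matrixP => x y; rewrite !mxE.
Qed.

(** The factors through the row and column bases are padded by zeros, so that the inner dimension is
    [c] whatever the rank. *)
Lemma rank_factorization p q c (N : 'M[F]_(p, q)) : (\rank N <= c)%N ->
  exists (P : 'M_(p, c)) (Q : 'M_(c, q)), N = P *m Q.
Proof.
move=> rc; exists (col_base N *m pid_mx (\rank N)), (pid_mx (\rank N) *m row_base N).
rewrite mulmxA -(mulmxA (col_base N)) mul_pid_mx minnn (minn_idPr rc) pid_mx_1.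
by rewrite mulmx1 mulmx_base.
Qed.

End RankMinors.

(** * Symmetric matrices and determinantal varieties *)

Section SymCells.
Variable n : nat.

Lemma sym_cellC (r s : 'I_n) : sym_cell r s = sym_cell s r.
Proof.
apply: val_inj => /=; case: (ssrnat.ltngtP r s) => // rs.
by have -> : r = s by apply: val_inj.
Qed.

Lemma sym_cell_val (x : sym_coord n) : sym_cell (val x).1 (val x).2 = x.
Proof. by apply: val_inj => /=; rewrite (valP x) -surjective_pairing. Qed.

Lemma sym_cell_cases (r s : 'I_n) :
  val (sym_cell r s) = (r, s) \/ val (sym_cell r s) = (s, r).
Proof. by rewrite /=; case: leqP; [left|right]. Qed.

Lemma sym_cell_eq (r s r' s' : 'I_n) : sym_cell r s = sym_cell r' s' ->
  (r = r' /\ s = s') \/ (r = s' /\ s = r').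
Proof.
move=> /(congr1 val); case: (sym_cell_cases r s) => ->;
case: (sym_cell_cases r' s') => -> [-> ->]; by [left|right].
Qed.

Definition sym_matrix (K : Type) (x : sym_coord n -> K) : 'M[K]_n :=
  \matrix_(r, s) x (sym_cell r s).

Lemma sym_matrix_tr K (x : sym_coord n -> K) : (sym_matrix x)^T = sym_matrix x.
Proof. by apply/matrixP => r s; rewrite !mxE sym_cellC. Qed.

Lemma sym_entry K (M : 'M[K]_n) r s : M^T = M ->
  M (val (sym_cell r s)).1 (val (sym_cell r s)).2 = M r s.
Proof.
move=> Ms; case: (sym_cell_cases r s) => -> //=.
by rewrite -[in RHS]Ms mxE.
Qed.

End SymCells.

Section MinorVarieties.
Variables (F : fieldType) (n : nat).

Lemma variety_ideal_gen (I : finType) (G : set (coord_ring F I)) x :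
  variety (ideal_gen G) x <-> forall p, G p -> peval p x = 0.
Proof.
split=> [Gx p Gp|Gx p [s [Gs ->]]].
  apply: Gx; exists [:: (1, p)]; split=> [q|]; last by rewrite big_seq1 mul1r.
  by rewrite inE => /eqP ->.
rewrite /peval rmorph_sum big_seq big1 // => q /Gs Gq.
by rewrite -[LHS]/(peval (q.1 * q.2) x) pevalM (Gx _ Gq) mulr0.
Qed.

Lemma variety_minors k (A B : {set 'I_n}) (x : Defs.point F (sym_coord n)) :
  variety (ideal_gen (minors k (sub_rc A B (generic_sym F n)))) x <->
  (\rank (sub_rc A B (sym_matrix x)) < k)%N.
Proof.
have minorE (f : 'I_k -> 'I_#|A|) (g : 'I_k -> 'I_#|B|) :
    peval (\det (mxsub f g (sub_rc A B (generic_sym F n)))) x =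
    \det (mxsub f g (sub_rc A B (sym_matrix x))).
  rewrite /peval -det_map_mx; congr (\det _); apply/matrixP => a b.
  by rewrite !mxE; apply: peval_var.
rewrite variety_ideal_gen -rank_lt_minors; split=> minors0 p.
  by case=> f [g [fi gi ->]]; rewrite -minorE; apply: minors0; exists f, g.
by case=> f [g [fi gi ->]]; rewrite minorE; apply: minors0; exists f, g.
Qed.

Lemma sub_rc_rank_factor c (A B : {set 'I_n}) (M : 'M[F]_n) :
  (\rank (sub_rc A B M) <= c)%N <->
  exists (X : 'M_(n, c)) (V : 'M_(c, n)),
    forall r s, r \in A -> s \in B -> M r s = (X *m V) r s.
Proof.
split=> [/rank_factorization [P [Q PQ]] | [X [V XV]]]; last first.
  have -> : sub_rc A B M = rowsub enum_val X *m colsub enum_val V.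
    apply/matrixP => a b; rewrite !mxE XV ?enum_valP // mxE.
    by apply: eq_bigr => k _; rewrite !mxE.
  by apply: leq_trans (mxrankM_maxr _ _) (rank_leq_row _).
(* At most one [a] enumerates [r], so each sum is an entry of [P] for [r] in [A] and 0 otherwise:
   the factors are extended by zero to all indices. *)
exists (\matrix_(r, k) \sum_(a | enum_val a == r) P a k).
exists (\matrix_(k, s) \sum_(b | enum_val b == s) Q k b).
move=> r s rA sB; rewrite mxE.
have /matrixP/(_ (enum_rank_in rA r) (enum_rank_in sB s)) := PQ.
rewrite !mxE !enum_rankK_in // => ->; apply: eq_bigr => k _; rewrite !mxE.
rewrite (eq_bigl (pred1 (enum_rank_in rA r))) => [|a]; last first.
  rewrite /= -{1}(enum_rankK_in rA rA) (inj_eq enum_val_inj) //.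
rewrite (eq_bigl (pred1 (enum_rank_in sB s))) => [|b]; last first.
  by rewrite /= -{1}(enum_rankK_in sB sB) (inj_eq enum_val_inj).
by rewrite !big_pred1_eq.
Qed.

End MinorVarieties.

(** * Parametrization by the cells meeting the central block *)

Section CentralBlock.
Variables n i c : nat.
Hypothesis icn : (i + c <= n)%N.

Lemma central_proof (k : 'I_c) : (i + k < n)%N.
Proof. by apply: leq_trans icn; rewrite ltn_add2l. Qed.

Definition central (k : 'I_c) : 'I_n := Ordinal (central_proof k).

Definition is_central (r : 'I_n) : bool := (i <= r < i + c)%N.

Lemma central_inj : injective central.
Proof. by move=> k l /(congr1 val) /= /addnI /val_inj. Qed.

Lemma is_central_central k : is_central (central k).
Proof. by rewrite /is_central /= leq_addr ltn_add2l ltn_ord. Qed.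

Lemma is_centralP r : is_central r -> exists k, r = central k.
Proof.
case/andP => ir ric; have rk : (r - i < c)%N by lia.
by exists (Ordinal rk); apply: val_inj; rewrite /= subnKC.
Qed.

Lemma card_central : #|[set r | is_central r]| = c.
Proof.
rewrite -[RHS]card_ord -cardsT -(card_imset _ central_inj); congr #|pred_of_set _|.
apply/setP => r; rewrite inE; apply/idP/imsetP => [/is_centralP [k ->]|[k _ ->]].
  by exists k.
exact: is_central_central.
Qed.

(* Entries with at least one index in the central block: on the open set where
   that block is invertible they determine a matrix of rank [c]. *)
Definition param : finType :=
  {x : sym_coord n | is_central (val x).1 || is_central (val x).2}.

Lemma param_cell_proof r k : let x := sym_cell r (central k) in
  is_central (val x).1 || is_central (val x).2.
Proof.
cbv zeta; case: (sym_cell_cases r (central k)) => ->;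
by rewrite /= is_central_central ?orbT.
Qed.

Definition param_cell r k : param :=
  exist _ (sym_cell r (central k)) (param_cell_proof r k).

Lemma param_cell_cases r k : val (val (param_cell r k)) = (r, central k) \/
  val (val (param_cell r k)) = (central k, r).
Proof. exact: sym_cell_cases. Qed.

Lemma param_cellC k l : param_cell (central k) l = param_cell (central l) k.
Proof. by apply: val_inj; rewrite /= sym_cellC. Qed.

Lemma param_cellP (x : param) : exists r k, x = param_cell r k.
Proof.
case/orP: (valP x) => /is_centralP [k xk].
  exists (val (val x)).2, k; apply: val_inj.
  by rewrite /= -xk sym_cellC sym_cell_val.
exists (val (val x)).1, k; apply: val_inj.
by rewrite /= -xk sym_cell_val.
Qed.

Lemma param_cell_eq r k r' k' : param_cell r k = param_cell r' k' ->
  (r = r' /\ k = k') \/ (r = central k' /\ r' = central k).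
Proof.
move=> /(congr1 val) /sym_cell_eq [[-> /central_inj ->]|[-> <-]]; by [left|right].
Qed.

(** A coordinate with both indices central has two names [param_cell r k]; the symmetry of [G] on
    central rows makes the two prescriptions agree. *)
Lemma param_point (K : fieldType) (G : 'I_n -> 'I_c -> K) :
  (forall k l, G (central k) l = G (central l) k) ->
  exists u : Defs.point K param, forall r k, u (param_cell r k) = G r k.
Proof.
move=> Gs; exists [ffun x => if [pick rk | param_cell rk.1 rk.2 == x] is Some rk
                             then G rk.1 rk.2 else 0] => r k.
rewrite ffunE; case: pickP => [[r' k'] /= /eqP|/(_ (r, k))]; last by rewrite eqxx.
by case/param_cell_eq => [[-> ->] //|[-> ->]]; rewrite Gs.
Qed.

Section Parametrization.
Variable K : comNzRingType.
Implicit Type u : param -> K.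

Definition frame u : 'M[K]_(n, c) :=
  \matrix_(r, k) if is_central r then (r == central k)%:R else u (param_cell r k).

Definition core u : 'M[K]_c := \matrix_(k, l) u (param_cell (central k) l).

Definition rank_c_mx u : 'M[K]_n := frame u *m core u *m (frame u)^T.

Lemma core_tr u : (core u)^T = core u.
Proof. by apply/matrixP => k l; rewrite !mxE param_cellC. Qed.

Lemma rank_c_mx_tr u : (rank_c_mx u)^T = rank_c_mx u.
Proof. by rewrite /rank_c_mx !trmx_mul trmxK core_tr mulmxA. Qed.

Lemma frame_central u : rowsub central (frame u) = 1%:M.
Proof. by apply/matrixP => k l; rewrite !mxE is_central_central (inj_eq central_inj). Qed.

Lemma rank_c_mx_central_col u : colsub central (rank_c_mx u) = frame u *m core u.
Proof.
have -> : colsub central (rank_c_mx u) =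
    frame u *m core u *m (rowsub central (frame u))^T.
  apply/matrixP => r k; rewrite !mxE; apply: eq_bigr => l _.
  by rewrite !mxE.
by rewrite frame_central trmx1 mulmx1.
Qed.

Lemma rank_c_mx_core u k l : rank_c_mx u (central k) (central l) = u (param_cell (central k) l).
Proof.
have := rank_c_mx_central_col u => /matrixP/(_ (central k) l).
rewrite [LHS]mxE => ->.
have -> : (frame u *m core u) (central k) l = (rowsub central (frame u) *m core u) k l.
  by rewrite !mxE; apply: eq_bigr => m _; rewrite !mxE.
by rewrite frame_central mul1mx mxE.
Qed.

Lemma rank_c_mx_core1 u r k : core u = 1%:M ->
  rank_c_mx u r (central k) = u (param_cell r k).
Proof.
move=> u1; have [/is_centralP [l ->]|rNC] := boolP (is_central r).
  exact: rank_c_mx_core.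
have := rank_c_mx_central_col u => /matrixP/(_ r k).
by rewrite [LHS]mxE => ->; rewrite u1 mulmx1 mxE (negPf rNC).
Qed.

End Parametrization.

Lemma map_rank_c_mx (K K' : comNzRingType) (phi : {rmorphism K -> K'})
    (u : param -> K) :
  map_mx phi (rank_c_mx u) = rank_c_mx (phi \o u).
Proof.
have mapf : map_mx phi (frame u) = frame (phi \o u).
  apply/matrixP => r k; rewrite !mxE; case: ifP => // _.
  by rewrite rmorph_nat.
have mapc : map_mx phi (core u) = core (phi \o u).
  by apply/matrixP => k l; rewrite !mxE.
by rewrite /rank_c_mx !map_mxM -map_trmx mapf mapc.
Qed.

(** Normalizing the central blocks [Xc] and [Vc] to the identity gives
    [X *m V = Xn *m (Xc *m Vc) *m Vn], where the middle factor is symmetric and serves as the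
    core. *)
Lemma rank_c_mx_generic (K : fieldType) (X : 'M[K]_(n, c)) (V : 'M[K]_(c, n)) :
  rowsub central X \in unitmx -> colsub central V \in unitmx ->
  (rowsub central X *m colsub central V)^T =
    rowsub central X *m colsub central V ->
  exists u : Defs.point K param, forall r s : 'I_n, (r < i + c)%N -> (i <= s)%N ->
    rank_c_mx u r s = (X *m V) r s.
Proof.
set Xc := rowsub central X; set Vc := colsub central V => uX uV XVs.
pose Xn := X *m invmx Xc; pose Vn := invmx Vc *m V.
have XnC k l : Xn (central k) l = (k == l)%:R.
  have : rowsub central Xn = 1%:M.
    by rewrite -(mulmxV uX);
       apply/matrixP => a b; rewrite !mxE; apply: eq_bigr => m _; rewrite !mxE.
  by move=> /matrixP/(_ k l); rewrite !mxE.
have VnC k l : Vn k (central l) = (l == k)%:R.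
  have : colsub central Vn = 1%:M.
    by rewrite -(mulVmx uV);
       apply/matrixP => a b; rewrite !mxE; apply: eq_bigr => m _; rewrite !mxE.
  by move=> /matrixP/(_ k l); rewrite !mxE eq_sym.
(* Indices before the central block occur only as rows of the product and take their frame row from
   [Xn]; indices after it occur only as columns and take it from [Vn]. *)
pose G r k := if is_central r then (X *m V) r (central k)
  else if (r < i)%N then Xn r k else Vn k r.
have XVc k l : (X *m V) (central k) (central l) = (Xc *m Vc) k l.
  by rewrite !mxE; apply: eq_bigr => m _; rewrite !mxE.
have Gs k l : G (central k) l = G (central l) k.
  by rewrite /G !is_central_central !XVc -[in RHS]XVs [RHS]mxE.
have [u uG] := param_point Gs; exists u => r s ric si.
have coreE : core u = Xc *m Vc.
  by apply/matrixP => k l; rewrite mxE uG /G is_central_central XVc.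
have rowE : row r (frame u) = row r Xn.
  apply/rowP => k; rewrite 2![LHS]mxE [RHS]mxE.
  have [/is_centralP [l ->]|rNC] := boolP (is_central r).
    by rewrite (inj_eq central_inj) XnC.
  by rewrite uG /G (negPf rNC) ifT //; move: rNC; rewrite /is_central; lia.
have colE : col s (frame u)^T = col s Vn.
  apply/colP => k; rewrite 3![LHS]mxE [RHS]mxE.
  have [/is_centralP [l ->]|sNC] := boolP (is_central s).
    by rewrite (inj_eq central_inj) VnC.
  by rewrite uG /G (negPf sNC) ifF //; move: sNC; rewrite /is_central; lia.
have entry (P : 'M[K]_(n, c)) (Q : 'M[K]_(c, n)) S :
    (P *m S *m Q) r s = (row r P *m S *m col s Q) 0 0.
  rewrite -row_mul [LHS]mxE [RHS]mxE; apply: eq_bigr => m _.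
  by rewrite [row _ _ _ _]mxE [col _ _ _ _]mxE.
rewrite /rank_c_mx entry rowE colE -entry coreE /Xn /Vn.
by rewrite -!mulmxA (mulmxA Vc) mulmxV // mul1mx (mulmxA (invmx _)) mulVmx // mul1mx.
Qed.

(** Complementary counting: from the cells on or below the diagonal one removes those with both
    indices outside the central block. The count is doubled to avoid halving in [nat]. *)
Lemma card_param : (2 * #|param| + (n - c) * (n - c).+1 = n * n.+1)%N.
Proof.
(* The cells on or below the diagonal and their mirror images cover the square of [D] and meet in
   its diagonal. *)
have lowcard (D : {set 'I_n}) :
    (2 * #|[set x : cell n | [&& (x.2 <= x.1)%N, x.1 \in D & x.2 \in D]]| =
     #|D| * #|D|.+1)%N.
  set low := finset _.
  pose up := [set x : cell n | [&& (x.1 <= x.2)%N, x.1 \in D & x.2 \in D]].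
  pose swap (x : cell n) : cell n := (x.2, x.1).
  have swapK : involutive swap by case.
  have upE : up = swap @: low.
    apply/setP => x; rewrite -[x in RHS]swapK (mem_imset _ _ (inv_inj swapK)).
    by rewrite !inE /= [(x.2 \in D) && _]andbC.
  have lowU : low :|: up = finset.setX D D.
    by apply/setP => -[a b]; rewrite !inE /= -andb_orl leq_total.
  have lowI : low :&: up = (fun a => (a, a)) @: D.
    apply/setP => -[a b]; rewrite !inE /=; apply/idP/imsetP => [|[d dD [-> ->]]].
      case/andP => /and3P[ba aD _] /and3P[ab _ _]; exists a => //.
      by congr (_, _); apply/val_inj/anti_leq; rewrite ab ba.
    by rewrite leqnn dD.
  have := cardsUI low up; rewrite lowU lowI cardsX upE card_imset; last exact: inv_inj.
  by rewrite card_imset => [DD|a b [] //]; rewrite mul2n -addnn -DD mulnS addnC.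
pose lowcells := [set x : cell n | (x.2 <= x.1)%N].
pose D := [set r | ~~ is_central r].
have cardD : #|D| = (n - c)%N.
  have -> : D = ~: [set r | is_central r] by apply/setP => r; rewrite !inE.
  by rewrite cardsCs finset.setCK card_central card_ord.
pose far := [set x : cell n | [&& (x.2 <= x.1)%N, x.1 \in D & x.2 \in D]].
have paramE : #|param| = #|lowcells :\: far|.
  pose f (x : param) : cell n := val (val x).
  have f_inj : injective f by move=> x y /val_inj /val_inj.
  rewrite -cardsT -(card_imset _ f_inj); congr #|pred_of_set _|.
  apply/setP => x; rewrite !inE; apply/imsetP/idP => [[y _ ->]|].
    by rewrite /f (valP (val y)) /= andbT -negb_or negbK (valP y).
  case/andP; rewrite negb_and => /orP[/negbTE->//|]; rewrite -negb_or negbK => xC xlow.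
  by exists (exist _ (exist _ x xlow) xC).
have lowT := lowcard finset.setT; have farE := lowcard D.
rewrite cardsT card_ord in lowT; rewrite cardD in farE.
have lowTE : [set x : cell n |
    [&& (x.2 <= x.1)%N, x.1 \in finset.setT & x.2 \in finset.setT]] = lowcells.
  by apply/setP => x; rewrite !inE !andbT.
rewrite lowTE in lowT.
have sub : far \subset lowcells by apply/fintype.subsetP => x; rewrite !inE => /andP[].
have := subset_leq_card sub; rewrite paramE cardsDS // -lowT -farE -/far; lia.
Qed.

End CentralBlock.

(** * Dimension of the variety of a block of bounded rank *)

Section CentralVariety.
Variables (F : numFieldType) (n : nat) (w : 'S_n) (i c : nat).
Hypothesis icn : (i + c <= n)%N.
Hypothesis Lset_w : Lset w = [set x : cell n | (i <= x.1)%N && (x.2 < i + c)%N].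

Let AC : {set 'I_n} := [set r : 'I_n | (r < i + c)%N].
Let BC : {set 'I_n} := [set r : 'I_n | (i <= r)%N].

Hypothesis X_sym_rank : forall x : Defs.point F (sym_coord n),
  X_sym F w x <-> (\rank (sub_rc AC BC (sym_matrix x)) <= c)%N.

Local Notation param := (param n i c).
Local Notation central := (central icn).

Lemma Y_coordE (x : sym_coord n) :
  (val x \in Lset w) || (((val x).2, (val x).1) \in Lset w) =
  (i <= (val x).1)%N && ((val x).2 < i + c)%N.
Proof.
have : ((val x).2 <= (val x).1)%N := valP x.
by rewrite Lset_w !inE /=; move: (val x) => -[r s] /=; lia.
Qed.

Lemma Y_coord_bounds (y : Y_coord w) :
  (i <= (val (val y)).1)%N && ((val (val y)).2 < i + c)%N.
Proof. by rewrite -Y_coordE (valP y). Qed.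

Lemma param_Y_proof (x : param) : (val (val x) \in Lset w) ||
  (((val (val x)).2, (val (val x)).1) \in Lset w).
Proof.
rewrite Y_coordE.
have : ((val (val x)).2 <= (val (val x)).1)%N := valP (val x).
have : is_central i c (val (val x)).1 || is_central i c (val (val x)).2 := valP x.
by move: (val (val x)) => -[r s] /=; rewrite /is_central; lia.
Qed.

Definition param_Y (x : param) : Y_coord w := exist _ (val x) (param_Y_proof x).

Definition Y_param (y : Y_coord w) : coord_ring F param :=
  rank_c_mx icn (coord_var F (I := param)) (val (val y)).1 (val (val y)).2.

Lemma pmap_eval_Y_param u y : pmap_eval Y_param u y =
  rank_c_mx icn u (val (val y)).1 (val (val y)).2.
Proof.
rewrite ffunE /Y_param.
have -> : rank_c_mx icn u =
    map_mx (fun p => peval p u) (rank_c_mx icn (coord_var F (I := param))).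
  rewrite (map_rank_c_mx _ (mpoly.meval (fun k => u (enum_val k)))).
  congr (rank_c_mx _ _); apply/funext => x /=; rewrite -[RHS]/(peval _ _).
  by rewrite peval_var.
by rewrite [RHS]mxE.
Qed.

Lemma Y_param_in_Y_sym u : Y_sym F w (pmap_eval Y_param u).
Proof.
exists [ffun x => rank_c_mx icn u (val x).1 (val x).2]; last first.
  by apply/ffunP => y; rewrite pmap_eval_Y_param !ffunE.
apply/X_sym_rank/sub_rc_rank_factor.
exists (frame icn u), (core icn u *m (frame icn u)^T) => r s _ _.
by rewrite [LHS]mxE ffunE sym_entry ?rank_c_mx_tr // /rank_c_mx mulmxA.
Qed.

Definition central_index (r : 'I_n) : option 'I_c := [pick k | central k == r].

Lemma central_indexK k : central_index (central k) = Some k.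
Proof.
rewrite /central_index; case: pickP => [l /eqP/central_inj -> //|/(_ k)].
by rewrite eqxx.
Qed.

(** A point of the variety is lifted to a factorization [X *m V], which is moved along a curve whose
    general points lie in the image of the parametrization; a polynomial vanishing at those points
    vanishes at parameter 0 too. *)
Lemma Y_param_dense p : (forall u, peval p (pmap_eval Y_param u) = 0) ->
  forall z, Y_sym F w z -> peval p z = 0.
Proof.
move=> p0 _ [x /X_sym_rank/sub_rc_rank_factor [X [V XV]] ->].
have centralA k : central k \in AC by rewrite inE /= ltn_add2l.
have centralB k : central k \in BC by rewrite inE /= leq_addr.
have XVs : (rowsub central X *m colsub central V)^T =
    rowsub central X *m colsub central V.
  have XVE k l : (rowsub central X *m colsub central V) k l =
      sym_matrix x (central k) (central l).
    by rewrite XV // !mxE; apply: eq_bigr => m _; rewrite !mxE.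
  by apply/matrixP => k l; rewrite mxE !XVE -[in LHS]sym_matrix_tr mxE.
have [Xt [Vt [X0 V0 XVts dX dV]]] := sym_product_curve XVs.
(* Only the central rows of [X] and the central columns of [V] move along the curve. *)
pose Xf : 'M[{poly F}]_(n, c) := \matrix_(r, k)
  if central_index r is Some l then Xt l k else (X r k)%:P.
pose Vf : 'M[{poly F}]_(c, n) := \matrix_(k, s)
  if central_index s is Some l then Vt k l else (V k s)%:P.
(* Coordinates are cells on or below the diagonal, while the factorization controls rows below
   [i + c] and columns from [i] on; hence the transposed position. *)
pose g (y : Y_coord w) := (Xf *m Vf) (val (val y)).2 (val (val y)).1.
have gE t y : (g y).[t] =
    (map_mx (horner_eval t) Xf *m map_mx (horner_eval t) Vf) (val (val y)).2 (val (val y)).1.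
  by rewrite -map_mxM [RHS]mxE.
have central_pick r l : central_index r = Some l -> r = central l.
  by rewrite /central_index; case: pickP => // k /eqP <- [->].
have Xf0 : map_mx (horner_eval 0) Xf = X.
  apply/matrixP => r k; rewrite !mxE; case E: (central_index r) => [l|].
    by rewrite (central_pick _ _ E); move/matrixP: X0 => /(_ l k); rewrite !mxE.
  by rewrite /horner_eval hornerC.
have Vf0 : map_mx (horner_eval 0) Vf = V.
  apply/matrixP => k s; rewrite !mxE; case E: (central_index s) => [l|].
    by rewrite (central_pick _ _ E); move/matrixP: V0 => /(_ k l); rewrite !mxE.
  by rewrite /horner_eval hornerC.
have Xfc t : rowsub central (map_mx (horner_eval t) Xf) = map_mx (horner_eval t) Xt.
  by apply/matrixP => k l; rewrite !mxE central_indexK.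
have Vfc t : colsub central (map_mx (horner_eval t) Vf) = map_mx (horner_eval t) Vt.
  by apply/matrixP => k l; rewrite !mxE central_indexK.
have [P PE] := peval_curve g p.
(* The determinants absorb the parameters at which a factor is singular, so that the product
   vanishes at every parameter. *)
have /eqP : P * (\det Xt * \det Vt) = 0.
  apply: poly_eq0_horner => t; rewrite !hornerM PE.
  have [->|dXt] := eqVneq (\det Xt).[t] 0; first by rewrite mul0r mulr0.
  have [->|dVt] := eqVneq (\det Vt).[t] 0; first by rewrite !mulr0.
  have uX : rowsub central (map_mx (horner_eval t) Xf) \in unitmx.
    by rewrite Xfc unitmxE det_map_mx unitfE.
  have uV : colsub central (map_mx (horner_eval t) Vf) \in unitmx.
    by rewrite Vfc unitmxE det_map_mx unitfE.
  have [|u uE] := rank_c_mx_generic uX uV.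
    by rewrite Xfc Vfc -map_mxM map_trmx XVts.
  suff -> : [ffun y => (g y).[t]] = pmap_eval Y_param u by rewrite p0 mul0r.
  apply/ffunP => y; rewrite pmap_eval_Y_param ffunE gE.
  have /andP[iy yc] := Y_coord_bounds y.
  by rewrite -uE // -[in LHS]rank_c_mx_tr mxE.
rewrite !mulf_eq0 (negPf dX) (negPf dV) !orbF => /eqP P0.
have <- : [ffun y => (g y).[0]] = [ffun y : Y_coord w => x (val y)].
  apply/ffunP => y; rewrite !ffunE gE Xf0 Vf0.
  have /andP[iy yc] := Y_coord_bounds y.
  by rewrite -XV ?inE // mxE sym_cellC sym_cell_val.
by rewrite -PE P0 horner0.
Qed.

Definition in_core (x : param) : bool :=
  is_central i c (val (val x)).1 && is_central i c (val (val x)).2.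

(** Sorting by this preorder puts the core coordinates last, so they stay frozen at the identity
    while the other coordinates are being freed. *)
Definition core_last (x y : param) : bool := in_core x ==> in_core y.

Definition identity_point : Defs.point F param :=
  [ffun x : param => ((val (val x)).1 == (val (val x)).2)%:R].

(** Core coordinates are always entries of the image. For any other [x], all core coordinates come
    later and are frozen, so [core u] is the identity and [rank_c_mx_core1] applies. *)
Lemma core_last_flag s1 x s2 : sort core_last (enum param) = s1 ++ x :: s2 ->
  forall u : Defs.point F param,
  (forall y, y \in s2 -> u y = identity_point y) ->
  pmap_eval Y_param u (param_Y x) = u x.
Proof.
move=> sE u us2; rewrite pmap_eval_Y_param /=.
have [xcore|xNcore] := boolP (in_core x).
  have [/is_centralP-/(_ icn)[k xk] /is_centralP-/(_ icn)[l xl]] := andP xcore.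
  rewrite xk xl rank_c_mx_core; congr (u _).
  by apply: val_inj; rewrite /= -xk -xl sym_cell_val.
have [r [k xE]] := param_cellP icn x.
have valx : val x = sym_cell r (central k) by rewrite xE.
rewrite valx sym_entry ?rank_c_mx_tr // rank_c_mx_core1 -?xE //.
have core_late y : in_core y -> y \in s2.
  move=> ycore; have : y \in sort core_last (enum param).
    by rewrite mem_sort mem_enum.
  have : pairwise core_last (sort core_last (enum param)).
    rewrite -sorted_pairwise.
      by apply: sort_sorted => a b; rewrite /core_last; do 2!case: in_core.
    by move=> a b d; rewrite /core_last; do 3!case: in_core.
  rewrite sE pairwise_cat mem_cat inE => /and3P[/allrelP s1x _ _].
  case/or3P => // [ys1|/eqP yx]; last by rewrite -yx ycore in xNcore.
  have := s1x y x ys1 (mem_head _ _).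
  by rewrite /core_last ycore (negPf xNcore).
apply/matrixP => a b; rewrite mxE us2.
  rewrite ffunE mxE; case: (param_cell_cases icn (central a) b) => -> /=.
    by rewrite (inj_eq (@central_inj _ _ _ icn)).
  by rewrite (inj_eq (@central_inj _ _ _ icn)) eq_sym.
apply: core_late; rewrite /in_core.
by case: (param_cell_cases icn (central a) b) => ->; rewrite !is_central_central.
Qed.

Lemma krull_dim_Y_sym (R : realType) : krull_dim R (Y_sym F w) = (#|param|%:R)%:E.
Proof.
have enum_perm : perm_eq (sort core_last (enum param)) (enum param).
  by rewrite perm_sort.
exact: (krull_dim_dominated Y_param_in_Y_sym Y_param_dense enum_perm core_last_flag).
Qed.

End CentralVariety.

(** * Weight cones *)

Section SpanDim.
Variable R : realType.

Lemma span_dim_basis m d (K : set 'rV[R]_m) (W : 'M[R]_(d, m)) : row_free W ->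
  (forall l, K (row l W)) -> (forall v, K v -> (v <= W)%MS) -> span_dim K = d.
Proof.
move=> Wfree KW sKW; apply/anti_leq/andP; split.
  apply/bigmax_leqP => k /asboolP [A [Afree KA]].
  rewrite -(eqP Afree) -(eqP Wfree); apply: mxrankS.
  by apply/row_subP => l; apply: sKW.
have dm : (d < m.+1)%N by rewrite ltnS -(eqP Wfree) rank_leq_col.
apply: (leq_bigmax_cond (Ordinal dm)).
by apply/asboolP; exists W.
Qed.

Lemma weight_cone_sub n (w : 'S_n) d (W : 'M[R]_(d, n + n)) :
  (forall x, x \in Lset w :&: low_cells n -> (weight R x <= W)%MS) ->
  forall v, weight_cone R w v -> (v <= W)%MS.
Proof.
move=> sW v [a [_ ->]]; apply: summx_sub => x xL.
exact/scalemx_sub/sW.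
Qed.

Lemma weight_in_cone n (w : 'S_n) x : x \in Lset w :&: low_cells n ->
  weight_cone R w (weight R x).
Proof.
move=> xL; exists (fun y => (y == x)%:R); split=> [y|]; first exact: ler0n.
rewrite (bigD1 x) //= eqxx scale1r big1 ?addr0 // => y /andP[_ /negPf ->].
by rewrite scale0r.
Qed.

Lemma span_dim_empty n (w : 'S_n) : Lset w = finset.set0 ->
  span_dim (weight_cone R w) = 0%N.
Proof.
move=> L0; apply: (@span_dim_basis _ 0 _ 0); first by rewrite /row_free mxrank0.
  by case.
apply: weight_cone_sub => x; by rewrite L0 !inE.
Qed.

Lemma weightE n (r s : 'I_n) :
  weight R (r, s) = row_mx (delta_mx 0 r) (- delta_mx 0 s).
Proof. by []. Qed.

(* The cells of the bottom row and of the first column form a spanning tree of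
   the bipartite graph on row and column indices whose edges are the cells. *)
Lemma span_dim_staircase n (w : 'S_n) i j : (i < n)%N -> (0 < j)%N -> (j <= n)%N ->
  Lset w = [set x : cell n | (i <= x.1)%N && (x.2 < j)%N] ->
  span_dim (weight_cone R w) = ((n - i) + j.-1)%N.
Proof.
case: n w => // n w lt_in j0 jn LE.
have row_lt (a : 'I_(n.+1 - i)) : (i + a < n.+1)%N by have := ltn_ord a; lia.
have col_lt (b : 'I_j.-1) : (b.+1 < n.+1)%N by have := ltn_ord b; lia.
pose W1 : 'M[R]_(n.+1 - i, n.+1 + n.+1) :=
  \matrix_a weight R (Ordinal (row_lt a), ord0 : 'I_n.+1).
pose W2 : 'M[R]_(j.-1, n.+1 + n.+1) :=
  \matrix_b weight R (ord_max : 'I_n.+1, Ordinal (col_lt b)).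
have W1P (r : 'I_n.+1) : (i <= r)%N -> (weight R (r, ord0 : 'I_n.+1) <= col_mx W1 W2)%MS.
  move=> ir; have rlt : (r - i < n.+1 - i)%N by have := ltn_ord r; lia.
  have -> : weight R (r, ord0 : 'I_n.+1) = row (Ordinal rlt) W1.
    by rewrite rowK; congr (weight _ (_, _)); apply: val_inj; rewrite /= subnKC.
  by apply: submx_trans (row_sub _ _) _; rewrite -addsmxE addsmxSl.
have W2P (s : 'I_n.+1) : (0 < s < j)%N ->
    (weight R (ord_max : 'I_n.+1, s) <= col_mx W1 W2)%MS.
  case/andP=> s0 sj; have slt : (s.-1 < j.-1)%N by lia.
  have -> : weight R (ord_max : 'I_n.+1, s) = row (Ordinal slt) W2.
    by rewrite rowK; congr (weight _ (_, _)); apply: val_inj; rewrite /= prednK.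
  by apply: submx_trans (row_sub _ _) _; rewrite -addsmxE addsmxSr.
apply: (span_dim_basis (W := col_mx W1 W2)).
- apply: inj_row_free => u; rewrite -[u]hsubmxK mul_row_col => uW0.
  have entry k : \sum_a lsubmx u 0 a * W1 a k + \sum_b rsubmx u 0 b * W2 b k = 0.
    by have /matrixP/(_ 0 k) := uW0; rewrite !mxE.
  (* The column vector of index [b.+1] occurs in a single row, which belongs to [W2]. Once these
     coefficients vanish, each row vector of index [i + a] isolates a row of [W1]. *)
  have u2 b : rsubmx u 0 b = 0.
    have := entry (rshift n.+1 (Ordinal (col_lt b))).
    rewrite big1 => [|a _]; last first.
      by rewrite [W1 _ _]mxE weightE row_mxEr !mxE /= oppr0 mulr0.
    rewrite (bigD1 b) //= big1 => [|b' b'b]; last first.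
      rewrite [W2 _ _]mxE weightE row_mxEr !mxE eqxx /=.
      by rewrite -val_eqE /= eqSS val_eqE eq_sym (negPf b'b) oppr0 mulr0.
    rewrite [W2 _ _]mxE weightE row_mxEr !mxE !eqxx /= add0r addr0 mulrN1 => /eqP.
    by rewrite oppr_eq0 => /eqP.
  have u1 a : lsubmx u 0 a = 0.
    have := entry (lshift n.+1 (Ordinal (row_lt a))).
    rewrite addrC big1 => [|b _]; last by rewrite u2 mul0r.
    rewrite (bigD1 a) //= big1 => [|a' a'a]; last first.
      rewrite [W1 _ _]mxE weightE row_mxEl !mxE eqxx /=.
      by rewrite -val_eqE /= eqn_add2l val_eqE eq_sym (negPf a'a) mulr0.
    by rewrite [W1 _ _]mxE weightE row_mxEl !mxE !eqxx /= add0r addr0 mulr1.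
  have -> : lsubmx u = 0 by apply/rowP => a; rewrite u1 [RHS]mxE.
  have -> : rsubmx u = 0 by apply/rowP => b; rewrite u2 [RHS]mxE.
  by rewrite row_mx0.
- move=> l; rewrite -[l]splitK; case: (split l) => [a|b] /=.
    have -> : row (lshift _ a) (col_mx W1 W2) = weight R (Ordinal (row_lt a), ord0 : 'I_n.+1).
      by rewrite rowKu rowK.
    by apply: weight_in_cone; rewrite LE !inE /= leq_addr j0.
  have -> : row (rshift _ b) (col_mx W1 W2) = weight R (ord_max : 'I_n.+1, Ordinal (col_lt b)).
    by rewrite rowKd rowK.
  by apply: weight_in_cone; rewrite LE !inE /=; have := ltn_ord b; lia.
- apply: weight_cone_sub => -[r s]; rewrite LE !inE /= => /andP[/andP[ir sj] sr].
  have [s0|s0] := posnP s.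
    have -> : s = ord0 by apply: val_inj.
    exact: W1P.
  (* The path in the tree from row [r] to column [s] runs through the first column and the bottom
     row. *)
  have -> : weight R (r, s) = weight R (r, ord0 : 'I_n.+1) +
      weight R (ord_max : 'I_n.+1, s) - weight R (ord_max : 'I_n.+1, ord0 : 'I_n.+1).
    rewrite !weightE opp_row_mx !add_row_mx addrK; congr row_mx.
    by rewrite opprK addrAC addNr add0r.
  by rewrite !addmx_sub ?eqmx_opp ?W1P ?W2P //= s0.
Qed.

End SpanDim.

(** * Diagrams *)

Section RectangularDiagram.
Variables (n : nat) (w : 'S_n) (r0 r1 c0 c1 : nat).
Hypotheses (r01 : (r0 < r1)%N) (r1n : (r1 <= n)%N) (c01 : (c0 < c1)%N) (c1n : (c1 <= n)%N).
Hypothesis rect : opp_diagram w =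
  [set x : cell n | (r0 <= x.1 < r1)%N && (c0 <= x.2 < c1)%N].

Lemma component_step x y :
  x \in opp_diagram w -> adjacent w x y -> y \in component w x.
Proof.
move=> xD xy; rewrite inE xD connect1 //.
by case/and3P: xy => _ ->.
Qed.

(** Any other cell of the rectangle has its upper or right neighbour in its own component, so the
    north-east corner is unique. *)
Lemma mem_Ess x : (x \in Ess w) = (x.1 == r0 :> nat) && (x.2.+1 == c1 :> nat).
Proof.
rewrite inE; apply/idP/idP => [/and3P[xx /forall_inP noup /forall_inP noright]|].
  have xD : x \in opp_diagram w by move: xx; rewrite inE => /andP[].
  case: x xD xx noup noright => r s xD _ noup noright.
  move: (xD); rewrite rect inE /= => xrect; apply/andP; split.
    apply/negPn/negP => rr0.
    have rlt : (r.-1 < n)%N by have := ltn_ord r; lia.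
    have /noup /= : ((Ordinal rlt, s) : cell n) \in component w (r, s).
      apply: component_step => //; rewrite /adjacent xD rect inE /= eqxx /=.
      by lia.
    by rewrite eqxx /=; lia.
  apply/negPn/negP => sc1.
  have slt : (s.+1 < n)%N by lia.
  have /noright /= : ((r, Ordinal slt) : cell n) \in component w (r, s).
    apply: component_step => //; rewrite /adjacent xD rect inE /= eqxx /=.
    by lia.
  by rewrite !eqxx.
case: x => r s /= /andP[/eqP rr0 /eqP sc1].
have xD : (r, s) \in opp_diagram w by rewrite rect inE /=; lia.
apply/and3P; split; first by rewrite inE xD connect0.
  by apply/forall_inP => -[a b]; rewrite inE rect inE => /andP[yD _] /=;
     rewrite -val_eqE /= in yD *; lia.
by apply/forall_inP => -[a b]; rewrite inE rect inE => /andP[yD _] /=;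
     rewrite -val_eqE /= in yD *; lia.
Qed.

Lemma SW_rect : SW w = [set x : cell n | (r0 <= x.1)%N && (x.2 < c1)%N].
Proof.
apply/setP => x; rewrite !inE; apply/exists_inP/idP => [[e]|xSW].
  by rewrite mem_Ess; lia.
have rn : (r0 < n)%N by lia.
have cn : (c1.-1 < n)%N by lia.
exists (Ordinal rn, Ordinal cn).
  by rewrite mem_Ess /= eqxx prednK ?eqxx //; apply: leq_ltn_trans c01.
by case: x xSW => a b /=; lia.
Qed.

Lemma dom_empty : (r1 < n)%N || (0 < c0)%N -> Defs.dom w = finset.set0.
Proof.
move=> off; apply/setP => d; rewrite !inE; apply/existsP => -[c /and3P[cr cc]].
rewrite inE => /and3P[_]; rewrite rect inE => cD _; lia.
Qed.

(** The rectangle contains the south-west corner of the grid, and each of its cells reaches that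
    corner by walking left and then down; the induction is on the distance to the corner. *)
Lemma dom_rect : r1 = n -> c0 = 0%N -> Defs.dom w = opp_diagram w.
Proof.
move=> r1E c0E; have n0 : (0 < n)%N by lia.
have ln : (n.-1 < n)%N by lia.
pose c : cell n := (Ordinal ln, Ordinal n0).
have cD : c \in opp_diagram w by rewrite rect inE /=; lia.
suff conn m (d : cell n) : (n - d.1 + d.2 <= m)%N -> d \in opp_diagram w ->
    connect (adjacent w) c d.
  apply/setP => d; rewrite inE; apply/existsP/idP => [[x /and3P[_ _]]|dD].
    by rewrite inE => /andP[].
  by exists c; rewrite inE dD cD (conn _ _ (leqnn _) dD) /= prednK // !eqxx.
elim: m d => [|m IH] [r s] /= rsm rsD; first by have := ltn_ord r; lia.
have := rsD; rewrite rect inE /= => rsr.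
have [s0|s0] := posnP s; last first.
  have slt : (s.-1 < n)%N by have := ltn_ord s; lia.
  pose y : cell n := (r, Ordinal slt).
  have yD : y \in opp_diagram w by rewrite rect inE /=; lia.
  apply: connect_trans (IH y _ yD) (connect1 _); first by rewrite /=; lia.
  by rewrite /adjacent yD rsD /= eqxx /=; lia.
have [rn|rn] := eqVneq (r.+1) n.
  have -> : (r, s) = c by congr (_, _); apply: val_inj => /=; lia.
  exact: connect0.
have rlt : (r.+1 < n)%N by have := ltn_ord r; lia.
pose y : cell n := (Ordinal rlt, s).
have yD : y \in opp_diagram w by rewrite rect inE /=; lia.
apply: connect_trans (IH y _ yD) (connect1 _); first by rewrite /=; lia.
by rewrite /adjacent yD rsD /= eqxx /=; lia.
Qed.

End RectangularDiagram.

(** * Diagrams of the two permutations *)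

Lemma size_decr b a : size (decr b a) = (b.+1 - a)%N.
Proof. by rewrite size_rev size_iota. Qed.

Lemma nth_decr b a k : (k < b.+1 - a)%N -> nth 0%N (decr b a) k = (b - k)%N.
Proof. by move=> kl; rewrite nth_rev ?size_iota // nth_iota; lia. Qed.

Lemma oneline_nth n (w : 'S_n) s (k : 'I_n) : oneline w = s ->
  (w k).+1 = nth 0%N s k.
Proof.
by move=> <-; rewrite (nth_map k) ?size_enum_ord // nth_ord_enum.
Qed.

(** Naming the row by its position [k], with row index [w k], removes the inverse permutation:
    diagram cells become the pairs of positions [b < k] with [w b < w k]. *)
Lemma opp_diagramP n (w : 'S_n) (D : {set cell n}) :
  (forall k b : 'I_n, ((w k, b) \in D) = (w b < w k)%N && (b < k)%N) ->
  opp_diagram w = D.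
Proof.
move=> DP; apply/setP => -[a b]; rewrite inE /= -[a in RHS](permKV w) DP.
by rewrite permKV.
Qed.

(** Runs are decreasing, so ascending pairs join different runs; here they go only from the first
    run to the second. Columns are positions of the first run, rows are values of the second, both
    shifted to start at 0. *)
Lemma opp_diagram_marginal n (w : 'S_n) i j : (1 <= i)%N -> (i < j)%N -> (j <= n)%N ->
  oneline w = decr (j - 1) (j - i) ++ decr n j ++ decr (j - i - 1) 1 ->
  opp_diagram w = [set x : cell n | (j.-1 <= x.1 < n)%N && (0 <= x.2 < i)%N].
Proof.
move=> i1 ij jn wE; apply: opp_diagramP => k b; rewrite inE.
have wk (l : 'I_n) : (w l).+1 = (if l < i then j.-1 - l
    else if l < i + (n.+1 - j) then n - (l - i)
    else j - i - 1 - (l - (i + (n.+1 - j))))%N.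
  rewrite (oneline_nth _ wE) !nth_cat !size_decr.
  have -> : ((j - 1).+1 - (j - i) = i)%N by lia.
  case: ifP => l1; first by rewrite nth_decr; lia.
  have -> : (l - i < n.+1 - j)%N = (l < i + (n.+1 - j))%N by lia.
  by case: ifP => l2; rewrite nth_decr; have := ltn_ord l; lia.
have := wk k; have := wk b; have := ltn_ord k; have := ltn_ord b; have := ltn_ord (w k).
move: (nat_of_ord (w k)) (nat_of_ord (w b)) => wk' wb /=.
move: (nat_of_ord k) (nat_of_ord b) => {wk}k {}b.
by do ?case: ifP => ?; lia.
Qed.

(** Here the ascending pairs go only from the second run to the third. *)
Lemma opp_diagram_saturated n (w : 'S_n) i j : (1 <= i)%N -> (i < j - 1)%N -> (j <= n)%N ->
  oneline w = decr n (n - j + i + 2) ++ decr i 1 ++ decr (n - j + i + 1) (i + 1) ->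
  opp_diagram w = [set x : cell n | (i <= x.1 < n - j + i + 1)%N && (j - 1 - i <= x.2 < j - 1)%N].
Proof.
move=> i1 ij jn wE; apply: opp_diagramP => k b; rewrite inE.
have wk (l : 'I_n) : (w l).+1 = (if l < j - 1 - i then n - l
    else if l < j - 1 then i - (l - (j - 1 - i))
    else n - j + i + 1 - (l - (j - 1)))%N.
  rewrite (oneline_nth _ wE) !nth_cat !size_decr.
  have -> : (n.+1 - (n - j + i + 2) = j - 1 - i)%N by lia.
  case: ifP => l1; first by rewrite nth_decr; lia.
  have -> : (l - (j - 1 - i) < i.+1 - 1)%N = (l < j - 1)%N by lia.
  by case: ifP => l2; rewrite nth_decr; have := ltn_ord l; lia.
have := wk k; have := wk b; have := ltn_ord k; have := ltn_ord b; have := ltn_ord (w k).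
move: (nat_of_ord (w k)) (nat_of_ord (w b)) => wk' wb /=.
move: (nat_of_ord k) (nat_of_ord b) => {wk}k {}b.
by do ?case: ifP => ?; lia.
Qed.

(** The rectangle reaches the south-west corner of the grid, so it is both the dominant component
    and the whole region south-west of its essential cell. *)
Lemma Lset_marginal n (w : 'S_n) i j : (1 <= i)%N -> (i < j)%N -> (j <= n)%N ->
  oneline w = decr (j - 1) (j - i) ++ decr n j ++ decr (j - i - 1) 1 ->
  Lset w = finset.set0.
Proof.
move=> i1 ij jn wE; have D := opp_diagram_marginal i1 ij jn wE.
have r01 : (j.-1 < n)%N by lia.
have c1n : (i <= n)%N by lia.
rewrite /Lset (SW_rect r01 (leqnn n) i1 c1n D) (dom_rect r01 (leqnn n) i1 c1n D) //.
apply/setP => x; rewrite D !inE ltn_ord andbT /=.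
by rewrite andNb.
Qed.

Lemma Lset_saturated n (w : 'S_n) i j : (1 <= i)%N -> (i < j - 1)%N -> (j <= n)%N ->
  oneline w = decr n (n - j + i + 2) ++ decr i 1 ++ decr (n - j + i + 1) (i + 1) ->
  Lset w = [set x : cell n | (i <= x.1)%N && (x.2 < j - 1)%N].
Proof.
move=> i1 ij jn wE; have D := opp_diagram_saturated i1 ij jn wE.
have r01 : (i < n - j + i + 1)%N by lia.
have r1n : (n - j + i + 1 <= n)%N by lia.
have c01 : (j - 1 - i < j - 1)%N by lia.
have c1n : (j - 1 <= n)%N by lia.
rewrite /Lset (SW_rect r01 r1n c01 c1n D) (dom_empty r01 r1n c01 c1n D) ?finset.setD0 //.
by apply/orP; right; lia.
Qed.

Lemma krull_dim_Y_sym_point (F : numFieldType) (R : realType) n (w : 'S_n) :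
  Lset w = finset.set0 -> (exists x, X_sym F w x) ->
  krull_dim R (Y_sym F w) = 0%:E.
Proof.
move=> L0 [x Xx].
have notin (c : cell n) : c \notin Lset w by rewrite L0 inE.
have noY (y : Y_coord w) : False by case/orP: (valP y); apply/negP/notin.
have eqpt (z z' : Defs.point F (Y_coord w)) : z = z'.
  by apply/ffunP => y; case: (noY y).
have YT z : Y_sym F w z by exists x; last exact: eqpt.
have Y0 : #|Y_coord w| = 0%N by apply: eq_card0 => y; case: (noY y).
(* The space has no coordinates and a single point, so it is dominated by itself with an empty
   flag. *)
have := @krull_dim_dominated F _ _ (@coord_var F (Y_coord w)) (Y_sym F w) _ _
  id [ffun=> 0] (enum (Y_coord w)) (perm_refl _) _ R.
rewrite Y0; apply=> [u|p p0 z _|s1 y]; [exact: YT| |by case: (noY y)].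
by rewrite -(p0 z); congr (peval _ _); apply: eqpt.
Qed.

Theorem proposition5p9 (R : realType) (n : nat) (w : 'S_n)
    (A B C : {set 'I_n}) (i j : nat) (i_gt0 : (1 <= i)%N) (j_le_n : (j <= n)%N)
    (X_CI : X_sym R[i] w = variety (CI_ideal R[i] A B C))
    (cases :
      [/\ (i < j)%N, A = index_itv n 1 i, B = index_itv n j n, C = finset.set0
        & oneline w = decr (j - 1) (j - i) ++ decr n j ++ decr (j - i - 1) 1]
      \/
      [/\ (i < j - 1)%N, A = index_itv n 1 i, B = index_itv n j n, C = index_itv n (i + 1) (j - 1)
        & oneline w = decr n (n - j + i + 2) ++ decr i 1
                        ++ decr (n - j + i + 1) (i + 1)]) :
  (C = finset.set0 -> complexity R w = 0%:E) /\
  (C <> finset.set0 ->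
     complexity R w =
       ((#|C|%:R - 1) * (n%:R - 1 - #|C|%:R / 2))%:E).
Proof.
case: cases => [[ij _ _ C0 wE]|[ij AE BE CE wE]].
  split=> [_|/(_ C0)] //; have L0 := Lset_marginal i_gt0 ij j_le_n wE.
  (* The zero matrix shows that the variety is nonempty; the dimension of an empty set would be
     [-oo]. *)
  have X0 : X_sym R[i] w [ffun=> 0].
    rewrite X_CI; apply/variety_minors.
    suff -> : sub_rc (A :|: C) (B :|: C) (sym_matrix [ffun=> 0 : R[i]]) = 0.
      by rewrite mxrank0.
    by apply/matrixP => r s; rewrite !mxE ffunE.
  rewrite /complexity (krull_dim_Y_sym_point R L0 (ex_intro _ _ X0)).
  by rewrite (span_dim_empty R L0) sube0.
pose c := (j - 1 - i)%N; have icj : (i + c = j - 1)%N by rewrite /c; lia.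
have icn : (i + c <= n)%N by lia.
have LE := Lset_saturated i_gt0 ij j_le_n wE; rewrite -icj in LE.
have Ccentral : C = [set r | is_central i c r].
  by rewrite CE; apply/setP => r; rewrite !inE /is_central; lia.
have cardC : #|C| = c by rewrite Ccentral (card_central icn).
have ACE : A :|: C = [set r : 'I_n | (r < i + c)%N].
  by rewrite AE CE; apply/setP => r; rewrite !inE; lia.
have BCE : B :|: C = [set r : 'I_n | (i <= r)%N].
  by rewrite BE CE; apply/setP => r; rewrite !inE; have := ltn_ord r; lia.
split=> [C0|_]; first by move: cardC; rewrite C0 cards0 /c; lia.
have XE (x : Defs.point R[i] (sym_coord n)) : X_sym R[i] w x <->
    (\rank (sub_rc [set r : 'I_n | (r < i + c)%N] [set r : 'I_n | (i <= r)%N]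
       (sym_matrix x)) <= c)%N.
  by rewrite X_CI /CI_ideal variety_minors ACE BCE cardC.
rewrite /complexity (krull_dim_Y_sym icn LE XE) (span_dim_staircase _ _ _ icn LE); try lia.
rewrite cardC -EFinB; congr (_%:E).
(* The cone has dimension [(n - i) + (i + c - 1) = n + c - 1], stated with a successor to avoid
   truncated subtraction; twice the dimension of the variety is
   [n (n + 1) - (n - c) (n - c + 1)]. *)
have := card_param icn; have : ((n - i + (i + c).-1).+1 = n + c)%N by rewrite /c; lia.
move: #|_| (n - i + (i + c).-1)%N => d s /(congr1 (fun m => m%:R : R)) sE.
move/(congr1 (fun m => m%:R : R)); rewrite natrD !natrM -(natr1 (n - c)) -(natr1 n).
rewrite -natr1 natrD in sE; rewrite natrB => [dE|]; last by lia.
have -> : (s%:R : R) = n%:R + c%:R - 1 by rewrite -sE addrK.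
have -> : (d%:R : R) = (n%:R * (n%:R + 1) - (n%:R - c%:R) * (n%:R - c%:R + 1)) / 2.
  by rewrite -dE; field.
by field.
Qed.
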